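(* Let $G$ be a multigraph with no cycles of length $3$ or $4$ and maximum degree $\Delta$. Then $\mathrm{ch}_a(G) \leq (2\sqrt{2} + o(1))\sqrt{\Delta/\ln\Delta}$, where $o(1)$ denotes a quantity depending only on $\Delta$ that tends to $0$ as $\Delta\to\infty$.
   Context: Multigraphs are finite and loopless; parallel edges (i.e. cycles of length 2) are allowed. Cycles of length 3 or 4 pass through 3 or 4 distinct vertices respectively. The degree of a vertex is the number of edges incident to it, counted with multiplicity, and the maximum degree is the largest degree of a vertex. Let $G=(V,E)$ be a multigraph, $\tau:E\to\mathbb{N}$ an edge labelling, and let each vertex $v$ be assigned a list $L(v)\subset\mathbb{N}$ of colours. A proper adaptable list colouring of $G$ (with respect to $\tau$ and the lists) is a map $\sigma:V\to\mathbb{N}$ with $\sigma(v)\in L(v)$ for every $v$ such that there is no edge $e=uv$ with $\tau(e)=\sigma(u)=\sigma(v)$. The adaptable choosability $\mathrm{ch}_a(G)$ is the smallest integer $k$ such that for every edge labelling $\tau$ of $G$ and every assignment of lists of size $k$ to the vertices of $G$ there exists a proper adaptable list colouring of $G$. *)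

(* Defs.v *)
From HB Require Import structures.
From mathcomp Require Import all_boot all_order all_algebra.
From mathcomp Require Import finmap.
From mathcomp Require Import all_classical all_reals all_analysis.

Set Implicit Arguments.
Unset Strict Implicit.
Unset Printing Implicit Defensive.

(* An edge is its own object and carries an unordered pair of distinct ends:
   parallel edges are allowed, loops are not. *)
Record multigraph := Multigraph {
  vertex : finType;
  edge : finType;
  ends : edge -> {set vertex};
  card_ends : forall e, #|ends e| = 2
}.

Definition degree (G : multigraph) (v : vertex G) : nat :=
  #|[set e : edge G | v \in ends e]|.

Definition max_degree (G : multigraph) : nat := \max_(v : vertex G) degree v.

(* [ordS] is the cyclic successor on ['I_k]; for [k = 2] a cycle is a pair of
   parallel edges. *)
Definition has_cycle (G : multigraph) (k : nat) : Prop :=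
  exists (c : k.-tuple (vertex G)) (d : k.-tuple (edge G)),
    [/\ uniq c, uniq d &
      forall i : 'I_k, ends (tnth d i) = [set tnth c i; tnth c (ordS i)]%SET].

Definition adaptable_list_colouring (G : multigraph) (tau : edge G -> nat)
    (L : vertex G -> {fset nat}) (sigma : vertex G -> nat) : Prop :=
  (forall v, sigma v \in L v) /\
  ~ (exists e u v,
       [/\ ends e = [set u; v]%SET, tau e = sigma u & tau e = sigma v]).

Definition adaptably_choosable (G : multigraph) (k : nat) : Prop :=
  forall (tau : edge G -> nat) (L : vertex G -> {fset nat}),
    (forall v, #|` L v|%fset = k) ->
    exists sigma, adaptable_list_colouring tau L sigma.

Lemma adaptably_choosable_card (G : multigraph) :
  adaptably_choosable G #|vertex G|.
Proof.
move=> tau L cardL.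
have inj_on (s : seq (vertex G)) : uniq s -> exists sigma : vertex G -> nat,
    (forall v, sigma v \in L v) /\ {in s &, injective sigma}.
  elim: s => [_|x s IHs /= /andP[xs us]].
    exists (fun v => head 0 (L v)); split=> // v.
    have : 0 < #|` L v|%fset by rewrite cardL; apply/card_gt0P; exists v.
    have : head 0 (L v) \in enum_fset (L v) \/ enum_fset (L v) = [::].
      by case: (enum_fset (L v)) => [|a t]; [right | left; rewrite /= mem_head].
    by case=> // ->.
  have [sigma [sigmaL sigmaI]] := IHs us.
  have [c cL cs] : exists2 c, c \in L x & c \notin map sigma s.
    case: (boolP (all (mem (map sigma s)) (L x))) => [/allP sub|/allPn[c ? ?]].
      have := uniq_leq_size (fset_uniq (L x)) sub.
      rewrite size_map -[size (L x)]/(#|` L x|%fset) cardL leqNgt.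
      have := max_card (mem (x :: s)).
      by rewrite (card_uniqP _) /= ?xs // => ->.
    by exists c.
  exists (fun v => if v == x then c else sigma v); split=> [v|u v].
    by case: eqP => [->|].
  rewrite !inE; case: (eqVneq u x) => [-> _|_ /= us'];
    case: (eqVneq v x) => [->|_] //= vs' E.
  - by case/negP: cs; rewrite E map_f.
  - by case/negP: cs; rewrite -E map_f.
  - exact: sigmaI.
have [sigma [sigmaL sigmaI]] := inj_on _ (enum_uniq (vertex G)).
exists sigma; split=> // -[e [u [v [eE tu tv]]]].
have uv : u = v by apply: sigmaI; rewrite ?mem_enum // -tu.
by have := card_ends e; rewrite eE uv finset.setUid cards1.
Qed.

Lemma adaptably_choosable_ex (G : multigraph) :
  exists k, `[< adaptably_choosable G k >].
Proof.
by exists #|vertex G|; apply/asboolP; exact: adaptably_choosable_card.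
Qed.

Definition adaptable_choosability (G : multigraph) : nat :=
  ex_minn (adaptably_choosable_ex G).

(* Main.v *)
(** Keep, in each list of size [k], the colours [c] such that at most
    [2 Delta / k] edges labelled [c] meet the vertex: by averaging these are at
    least half of the list.  So it suffices to colour when all lists have size
    at least [x = k / 2] and all colour degrees are at most [y = 2 Delta / k],
    where [y / x = 4 Delta / k ^ 2] is at most [(1 / 2 - c) ln Delta].

    This is done by a semi-random procedure.  In a round every vertex tries each
    colour of its list independently with probability [eps / y]; it gets a tried
    colour that no neighbour tries, and loses the colours tried by neighbours.
    Extra coins make every colour survive with the same probability, about
    [exp (- eps)].  As there are no cycles of length 3 or 4, the fates of the
    neighbours of a vertex are independent once its own trials are fixed, and
    Chernoff bounds with the local lemma yield an outcome in which [x] decreases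
    by a factor [exp (- eps)] and [y / x] decreases by [eps], up to
    [O (eps ^ 2)].  Hence [x] has decreased only by a factor [Delta ^ (1 / 2 - c')]
    when [y / x] drops below [1 / 16], and then the local lemma applies to a
    uniformly random choice of colours. *)

Require Import Defs.
From mathcomp Require Import all_boot all_order all_algebra finmap.
From mathcomp Require Import ring lra zify.
From mathcomp Require Import reals sequences exp.
From mathcomp Require boolp.
Set Implicit Arguments.
Unset Strict Implicit.
Unset Printing Implicit Defensive.
Import Order.TTheory GRing.Theory Num.Theory.
Local Open Scope ring_scope.

(** * Product measures and the local lemma *)

Section ProductMeasure.

Variables (R : realFieldType) (T A : finType) (mu : T -> A -> R).
Hypothesis mu_ge0 : forall t a, 0 <= mu t a.
Hypothesis mu_sum1 : forall t, \sum_a mu t a = 1.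

Local Notation Omega := {ffun T -> A}.

Definition weight (w : Omega) : R := \prod_t mu t (w t).

Definition expect (f : Omega -> R) : R := \sum_w weight w * f w.

Definition Prob (B : pred Omega) : R := expect (fun w => (B w)%:R).

(** Independence is always derived from disjoint sets of coordinates, so this notion takes the place
    of sigma-algebras. *)
Definition depends_on (Y : Type) (S : {set T}) (f : Omega -> Y) : Prop :=
  forall w w' : Omega, (forall t, t \in S -> w t = w' t) -> f w = f w'.

Lemma weight_ge0 w : 0 <= weight w.
Proof. by apply: prodr_ge0 => t _. Qed.

Lemma eq_expect f g : f =1 g -> expect f = expect g.
Proof. by move=> fg; apply: eq_bigr => w _; rewrite fg. Qed.

Lemma expect_prod (g : T -> A -> R) :
  expect (fun w => \prod_t g t (w t)) = \prod_t \sum_a mu t a * g t a.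
Proof.
rewrite bigA_distr_bigA; apply: eq_bigr => w _.
by rewrite -big_split.
Qed.

Lemma expect_cst c : expect (fun=> c) = c.
Proof.
rewrite /expect -mulr_suml.
have -> : \sum_w weight w = expect (fun w => \prod_(t : T) 1).
  by apply: eq_bigr => w _; rewrite big1_eq mulr1.
rewrite (expect_prod (fun _ _ => 1)) big1 ?mul1r // => t _.
by rewrite -mulr_suml mu_sum1 mul1r.
Qed.

Lemma expect_coord t (g : A -> R) :
  expect (fun w => g (w t)) = \sum_a mu t a * g a.
Proof.
pose h s a := if s == t then g a else 1.
rewrite (eq_expect (g := fun w => \prod_s h s (w s))) => [|w].
  rewrite expect_prod (bigD1 t) //= /h eqxx [X in _ * X]big1 ?mulr1 // => s /negbTE ->.
  by rewrite -mulr_suml mu_sum1 mul1r.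
by rewrite (bigD1 t) //= /h eqxx big1 ?mulr1 // => s /negbTE ->.
Qed.

Lemma ler_expect f g : (forall w, f w <= g w) -> expect f <= expect g.
Proof. by move=> fg; apply: ler_sum => w _; rewrite ler_wpM2l ?weight_ge0. Qed.

Lemma expectZl c f : expect (fun w => c * f w) = c * expect f.
Proof. by rewrite mulr_sumr; apply: eq_bigr => w _; rewrite mulrCA. Qed.

Lemma expectD f g : expect (fun w => f w + g w) = expect f + expect g.
Proof. by rewrite -big_split; apply: eq_bigr => w _; rewrite mulrDr. Qed.

Lemma expect_sum (I : finType) (P : pred I) (f : I -> Omega -> R) :
  expect (fun w => \sum_(i | P i) f i w) = \sum_(i | P i) expect (f i).
Proof.
rewrite exchange_big; apply: eq_bigr => w _; by rewrite mulr_sumr.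
Qed.

Lemma expect_ge0 f : (forall w, 0 <= f w) -> 0 <= expect f.
Proof. by move=> f0; apply: sumr_ge0 => w _; rewrite mulr_ge0 ?weight_ge0. Qed.

Lemma prob_ge0 B : 0 <= Prob B.
Proof. by apply: expect_ge0 => w; case: (B w). Qed.

(* Exchanging the [S]-coordinates of two independent samples preserves their
   joint law. *)
Lemma expectM S S' f g : depends_on S f -> depends_on S' g ->
  [disjoint S & S'] -> expect (fun w => f w * g w) = expect f * expect g.
Proof.
move=> df dg SS'.
pose mix (w w' : Omega) : Omega := [ffun t => if t \in S then w t else w' t].
pose h (x : Omega * Omega) := (mix x.1 x.2, mix x.2 x.1).
have hK : involutive h.
  by move=> [w w']; rewrite /h /=; congr (_, _); apply/ffunP => t; rewrite !ffunE; case: (t \in S).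
have -> : expect f * expect g
    = \sum_(x : Omega * Omega) weight x.1 * weight x.2 * (f x.1 * g x.2).
  rewrite /expect big_distrlr /= pair_big; apply: eq_bigr => -[w w'] _ /=.
  by rewrite mulrACA.
rewrite (reindex_inj (inv_inj hK)) /=.
transitivity (\sum_(x : Omega * Omega) weight x.2 * (weight x.1 * (f x.1 * g x.1))).
  rewrite -(pair_big xpredT xpredT
    (fun w w' => weight w' * (weight w * (f w * g w)))) /=.
  apply: eq_bigr => w _; rewrite -mulr_suml -[LHS]mul1r; congr (_ * _).
  by rewrite -[LHS](expect_cst 1); apply: eq_bigr => ? _; rewrite mulr1.
apply: eq_bigr => -[w w'] _ /=; rewrite mulrA; congr (_ * (_ * _)).
- rewrite /weight -!big_split; apply: eq_bigr => t _ /=.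
  by rewrite !ffunE; case: ifP => _; rewrite // mulrC.
- by apply: df => t tS; rewrite ffunE tS.
- apply: dg => t tS'; rewrite ffunE; case: ifP => // tS.
  by rewrite (disjointFr SS' tS) in tS'.
Qed.

Lemma depends_on_sub (Y : Type) (S S' : {set T}) (f : Omega -> Y) :
  S \subset S' -> depends_on S f -> depends_on S' f.
Proof.
by move=> /subsetP sub df w w' ww'; apply: df => t /sub; exact: ww'.
Qed.

Lemma expect_prod_indep (I : finType) (P : pred I) (S : I -> {set T})
    (f : I -> Omega -> R) :
  (forall i, P i -> depends_on (S i) (f i)) ->
  (forall i j, P i -> P j -> i != j -> [disjoint S i & S j]) ->
  expect (fun w => \prod_(i | P i) f i w) = \prod_(i | P i) expect (f i).
Proof.
move=> df dS.
elim: (index_enum I) (index_enum_uniq I) => [_|i s IHs /= /andP[i_s us]].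
  by rewrite big_nil -[RHS](expect_cst 1); apply: eq_expect => w; rewrite big_nil.
rewrite big_cons -IHs //; case: ifP => Pi; last first.
  by apply: eq_expect => w; rewrite big_cons Pi.
pose S' := \bigcup_(j | (j \in s) && P j) S j.
rewrite -(@expectM (S i) S'); last first.
- apply/bigcup_disjointP => j /andP[js Pj].
  by rewrite dS //; apply: contraNneq i_s => ->.
- move=> w w' ww'; rewrite big_seq_cond [RHS]big_seq_cond.
  apply: eq_bigr => j js; have /andP[_ Pj] := js.
  by apply: (df j Pj) => t tj; apply: ww'; apply/bigcupP; exists j.
- exact: df.
by apply: eq_expect => w; rewrite big_cons Pi.
Qed.

Section LocalLemma.

Variables (I : finType) (B : I -> pred Omega) (vbl : I -> {set T}).
Variables p D : R.
Hypothesis B_dep : forall i, depends_on (vbl i) (B i).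
Hypothesis B_prob : forall i, Prob (B i) <= p.
Hypothesis vbl_degree :
  forall i, #|[set j | ~~ [disjoint vbl i & vbl j]]|%:R <= D.
Hypothesis D_ge1 : 1 <= D.
Hypothesis pD : 4 * p * D <= 1.

Let avoid (J : {set I}) (w : Omega) := [forall (j | j \in J), ~~ B j w].

Let p_ge0 (i : I) : 0 <= p.
Proof. exact: le_trans (prob_ge0 _) (B_prob i). Qed.

Let avoid_sub (J K : {set I}) w : J \subset K -> avoid K w -> avoid J w.
Proof.
move=> /subsetP sub /forall_inP a; apply/forall_inP => j /sub; exact: a.
Qed.

Let prob_avoid_split (J K : {set I}) :
  Prob (avoid J) <=
  Prob (avoid (J :|: K)) + \sum_(k in K) Prob (fun w => B k w && avoid J w).
Proof.
rewrite -expect_sum -expectD; apply: ler_expect => w.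
case aJ: (avoid J w) => /=; last by rewrite addr_ge0 ?sumr_ge0.
case: (boolP (avoid (J :|: K) w)) => [_|].
  by rewrite lerDl sumr_ge0.
rewrite negb_forall_in => /exists_inP[k]; rewrite finset.in_setU => /orP[kJ|kK].
  by move/forall_inP: aJ => /(_ k kJ) ->.
rewrite negbK => Bk; rewrite add0r (bigD1 k) //= Bk lerDl sumr_ge0 // => j _.
Qed.

(** The usual estimate P([B i] | [avoid J]) <= 2 p, multiplied out so that no division by a possibly
    zero probability occurs. [B i] is independent of the events of [J] that share no variable with
    it; by induction and the union bound, the others take away at most 2 p D <= 1/2 of the
    probability of avoiding those. *)
Let local_step n (J : {set I}) i : (#|J| < n)%N ->
  Prob (fun w => B i w && avoid J w) <= 2 * p * Prob (avoid J).
Proof.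
elim: n J i => // n IHn J i Jn.
pose N := [set j | ~~ [disjoint vbl i & vbl j]].
pose J1 := J :&: N; pose J2 := J :\: N.
have JU : J2 :|: J1 = J by rewrite setUC setID.
have bound : Prob (fun w => B i w && avoid J w) <= p * Prob (avoid J2).
  apply: le_trans (ler_wpM2r (prob_ge0 _) (B_prob i)).
  rewrite -(@expectM (vbl i) (\bigcup_(j in J2) vbl j)).
  - apply: ler_expect => w; rewrite -natrM mulnb ler_nat.
    case: (B i w) => //=; case aJ: (avoid J w) => //.
    by rewrite (avoid_sub _ aJ) // subsetDl.
  - by move=> w w' ww'; rewrite (B_dep ww').
  - move=> w w' ww'; congr (_%:R); congr (nat_of_bool _).
    apply: eq_forallb_in => j jJ; congr (~~ _); apply: B_dep => t tj.
    by apply: ww'; apply/bigcupP; exists j.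
  - apply/bigcup_disjointP => j.
    by rewrite !inE negbK => /andP[].
apply: le_trans bound _.
rewrite [2 * p]mulrC -mulrA ler_wpM2l ?(p_ge0 i) //.
(* The induction hypothesis needs [J2] strictly smaller than [J], so an empty [J1] is treated
   apart. *)
case: (eqVneq J1 set0) => [J10|J1n0].
  by rewrite -[in X in _ <= X]JU J10 setU0; have := prob_ge0 (avoid J2); lra.
have J2n : (#|J2| < n)%N.
  rewrite -ltnS; apply: leq_trans Jn; rewrite ltnS -JU cardsU.
  have -> : J2 :&: J1 = set0.
    by apply/setP => j; rewrite in_setI in_setD in_setI in_set0; case: (j \in N); rewrite /= ?andbF.
  by rewrite cards0 subn0 -addn1 leq_add2l card_gt0.
have := prob_avoid_split J2 J1; rewrite JU => split2.
have sum_le : \sum_(k in J1) Prob (fun w => B k w && avoid J2 w)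
    <= 2^-1 * Prob (avoid J2).
  apply: (@le_trans _ _ (\sum_(k in J1) 2 * p * Prob (avoid J2))).
    by apply: ler_sum => k _; exact: IHn.
  rewrite sumr_const -[_ *+ #|_|]mulr_natl mulrA ler_wpM2r ?prob_ge0 //.
  have : (#|J1|%:R : R) <= D.
    by apply: le_trans (vbl_degree i); rewrite ler_nat subset_leq_card ?subsetIr.
  move/(ler_wpM2r (p_ge0 i)); move: pD; nra.
by move: split2 sum_le; lra.
Qed.

(** All events are avoided with positive probability, so some outcome of positive weight avoids
    them. Positive weight puts every coordinate in its support; [colourable_sparse] reads off from
    this that the colours come from the lists. *)
Lemma local_lemma : exists2 w, 0 < weight w & forall i, ~~ B i w.
Proof.
have pos n (J : {set I}) : #|J| = n -> 0 < Prob (avoid J).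
  elim: n J => [|n IHn] J Jn.
    rewrite (cards0_eq Jn) -[X in _ < X]/(Prob _).
    have -> : Prob (avoid set0) = expect (fun=> 1).
      apply: eq_expect => w; rewrite [avoid _ _](_ : _ = true) //.
      by apply/forall_inP => j; rewrite inE.
    by rewrite expect_cst.
  have /card_gt0P[i iJ] : (0 < #|J|)%N by rewrite Jn.
  have Jin : #|J :\ i| = n by move: Jn; rewrite (cardsD1 i) iJ => -[].
  have := prob_avoid_split (J :\ i) [set i].
  rewrite big_set1 setUC setD1K // => split1.
  have := local_step i (ltnSn #|J :\ i|); have := IHn _ Jin.
  have p0 := p_ge0 i.
  have : 4 * p <= 1 by apply: le_trans pD; rewrite ler_peMr // mulr_ge0.
  by move=> ? ? ?; nra.
have := pos _ [set: I] erefl.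
case: (pickP (fun w => avoid [set: I] w && (0 < weight w))) => [w|none].
  by move=> /andP[/forall_inP aw w0] _; exists w => // i; apply: aw.
rewrite /Prob /expect big1 ?ltxx // => w _; move: (none w).
case: (avoid _ w) => /= [/negbT|_]; last by rewrite mulr0.
by rewrite lt_def weight_ge0 andbT negbK => /eqP ->; rewrite mul0r.
Qed.

End LocalLemma.

End ProductMeasure.

(** * Chernoff bounds *)

Lemma subset_of_card (T : finType) (S : {set T}) n :
  (n <= #|S|)%N -> exists2 S' : {set T}, S' \subset S & #|S'| = n.
Proof.
move=> nS; exists [set x in take n (enum S)].
  by apply/subsetP => x; rewrite inE => /mem_take; rewrite mem_enum.
rewrite cardsE (card_uniqP _) ?take_uniq ?enum_uniq // size_takel //.
by rewrite -cardE.
Qed.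

Lemma expR_sub1_le (R : realType) (l : R) : 0 <= l <= 2^-1 ->
  expR l - 1 <= l + 2 * l ^+ 2.
Proof.
move=> /andP[l0 l1]; have l1' : 0 < 1 - l by lra.
have : expR l <= (1 - l)^-1.
  rewrite -[l in expR l]opprK expRN lef_pV2 ?posrE ?expR_gt0 //.
  exact: expR_ge1Dx.
move=> /le_trans -/(_ (1 + l + 2 * l ^+ 2)) bound.
rewrite lerBlDl addrA bound // -div1r ler_pdivrMr //; nra.
Qed.

Lemma expRN_le (R : realType) (l : R) : 0 <= l -> expR (- l) <= 1 - l + l ^+ 2.
Proof.
move=> l0; have l1 : 0 < 1 + l by lra.
rewrite expRN; apply: (@le_trans _ _ (1 + l)^-1).
  by rewrite lef_pV2 ?posrE ?expR_gt0 ?expR_ge1Dx.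
by rewrite -div1r ler_pdivrMr //; nra.
Qed.

Section Chernoff.

Variables (R : realType) (T A : finType) (mu : T -> A -> R).
Hypothesis mu_ge0 : forall t a, 0 <= mu t a.
Hypothesis mu_sum1 : forall t, \sum_a mu t a = 1.
Variables (I : finType) (P : pred I) (S : I -> {set T}).
Variable B : I -> pred {ffun T -> A}.
Hypothesis B_dep : forall i, P i -> depends_on (S i) (B i).
Hypothesis S_disj :
  forall i j, P i -> P j -> i != j -> [disjoint S i & S j].

Local Notation prob := (Prob mu).

Let X w : R := \sum_(i | P i) (B i w)%:R.

(** By independence the expectation factors, and each factor is 1 + P([B i]) (exp l - 1). As [l] may
    have either sign, this serves both tails. *)
Lemma expect_expR_sum l :
  expect mu (fun w => expR (l * X w)) <=
  expR (\sum_(i | P i) prob (B i) * (expR l - 1)).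
Proof.
rewrite (eq_expect _ (g := fun w => \prod_(i | P i) expR (l * (B i w)%:R))).
  rewrite (expect_prod_indep mu_sum1 (S := S)) //; last first.
    by move=> i Pi w w' ww'; rewrite (B_dep Pi ww').
  rewrite expR_sum; apply: ler_prod => i _; apply/andP; split.
    by apply: expect_ge0 => // w; exact: expR_ge0.
  apply: le_trans (expR_ge1Dx _).
  rewrite (eq_expect _ (g := fun w => 1 + (expR l - 1) * (B i w)%:R)).
    by rewrite expectD expect_cst // expectZl mulrC.
  move=> w; case: (B i w); rewrite ?mulr1 ?mulr0 ?expR0; ring.
by move=> w; rewrite /X mulr_sumr expR_sum.
Qed.

Lemma upper_tail (d a y : R) : 0 <= d <= 1 -> 0 <= a ->
  (forall i, P i -> prob (B i) <= a) -> #|P|%:R <= y ->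
  prob (fun w => (1 + d) * a * y <= X w) <= expR (- (d ^+ 2 * (a * y) / 8)).
Proof.
move=> /andP[d0 d1] a0 Ba Py.
(* With this [l] the exponent per unit of a y is at most - l (1 + d) + l + 2 l ^ 2 = - d ^ 2 / 8. *)
pose l := d / 4.
have l0 : 0 <= l by rewrite /l; lra.
apply: (@le_trans _ _ (expect mu (fun w =>
    expR (- (l * ((1 + d) * a * y))) * expR (l * X w)))).
  apply: ler_expect => // w; case: (boolP ((1 + d) * a * y <= X w)) => [tX|_]; last first.
    by rewrite mulr0n mulr_ge0 ?expR_ge0.
  by rewrite mulr1n -expRD -[X in X <= _]expR0 ler_expR addrC subr_ge0 ler_wpM2l.
rewrite expectZl.
apply: le_trans (ler_wpM2l (expR_ge0 _) (expect_expR_sum l)) _.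
rewrite -expRD ler_expR.
have e0 : 0 <= expR l - 1 by rewrite subr_ge0 -expR0 ler_expR.
have : \sum_(i | P i) prob (B i) * (expR l - 1) <= y * (a * (expR l - 1)).
  apply: (@le_trans _ _ (\sum_(i | P i) a * (expR l - 1))).
    by apply: ler_sum => i Pi; rewrite ler_wpM2r ?Ba.
  by rewrite sumr_const -[_ *+ #|_|]mulr_natl ler_wpM2r // mulr_ge0.
have : expR l - 1 <= l + 2 * l ^+ 2 by apply: expR_sub1_le; rewrite /l; lra.
have y0 : 0 <= y by apply: le_trans Py.
move/(ler_wpM2l (mulr_ge0 a0 y0)); rewrite /l; nra.
Qed.

Lemma lower_tail (d q x : R) : 0 <= d <= 1 -> 0 <= q -> 0 <= x ->
  (forall i, P i -> q <= prob (B i)) -> x <= #|P|%:R ->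
  prob (fun w => X w <= (1 - d) * q * x) <= expR (- (d ^+ 2 * (q * x) / 4)).
Proof.
move=> /andP[d0 d1] q0 x0 Bq Px.
(* Here the exponent per unit of q x is at most l (1 - d) - l + l ^ 2 = - d ^ 2 / 4. *)
pose l := d / 2.
have l0 : 0 <= l by rewrite /l; lra.
apply: (@le_trans _ _ (expect mu (fun w =>
    expR (l * ((1 - d) * q * x)) * expR (- l * X w)))).
  apply: ler_expect => // w; case: (boolP (X w <= (1 - d) * q * x)) => [tX|_]; last first.
    by rewrite mulr0n mulr_ge0 ?expR_ge0.
  by rewrite mulr1n -expRD -[X in X <= _]expR0 ler_expR mulNr subr_ge0 ler_wpM2l.
rewrite expectZl.
apply: le_trans (ler_wpM2l (expR_ge0 _) (expect_expR_sum (- l))) _.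
rewrite -expRD ler_expR.
have e0 : 0 <= 1 - expR (- l) by rewrite subr_ge0 -expR0 ler_expR oppr_le0.
have : x * (q * (1 - expR (- l))) <= \sum_(i | P i) prob (B i) * (1 - expR (- l)).
  apply: (@le_trans _ _ (\sum_(i | P i) q * (1 - expR (- l)))).
    by rewrite sumr_const -[_ *+ #|_|]mulr_natl ler_wpM2r // mulr_ge0.
  by apply: ler_sum => i Pi; rewrite ler_wpM2r ?Bq.
rewrite -!mulr_suml.
have := expRN_le l0; have qx0 := mulr_ge0 q0 x0.
move=> /(ler_wpM2l qx0); rewrite /l; nra.
Qed.

End Chernoff.

(** * Lists and colour degrees *)

Lemma natr_forall_in (R : comNzRingType) (I : finType) (P b : pred I) :
  [forall (i | P i), b i]%:R = \prod_(i | P i) (b i)%:R :> R.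
Proof.
case: (boolP [forall (i | P i), b i]) => [/forall_inP h|].
  by rewrite big1 // => i /h ->.
by rewrite negb_forall_in => /exists_inP[i Pi /negbTE bi]; rewrite (bigD1 i) //= bi mul0r.
Qed.

Lemma card_bigcup_le (I J : finType) (A : {set I}) (F : I -> {set J}) m :
  (forall i, #|F i| <= m)%N -> (#|\bigcup_(i in A) F i| <= #|A| * m)%N.
Proof.
move=> Fm; rewrite -sum_nat_const.
elim/big_ind2: _ => [|k X l Y Xk Yl|//]; first by rewrite cards0.
by apply: leq_trans (leq_card_setU X Y) _; rewrite leq_add.
Qed.

Section ConflictColouring.

Variables (R : realType) (V C : finType) (E : C -> rel V).
Hypothesis E_sym : forall c, symmetric (E c).
Hypothesis E_irr : forall c, irreflexive (E c).
Variable c0 : C.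

Definition colour_nbrs (U : {set V}) (L : V -> {set C}) v c : {set V} :=
  [set u in U | E c u v & c \in L u].

Definition conflict_free (U : {set V}) (L : V -> {set C}) (s : V -> C) : Prop :=
  (forall v, v \in U -> s v \in L v) /\
  (forall u v, u \in U -> v \in U -> s u = s v -> ~~ E (s u) u v).

(** Quantifying over all uncoloured sets [U] and all lists lets the outcome of a round serve as the
    input of the next; real [x] and [y] avoid rounding between rounds. *)
Definition colourable (x y : R) : Prop :=
  forall (U : {set V}) (L : V -> {set C}),
    (forall v, v \in U -> x <= #|L v|%:R) ->
    (forall v c, v \in U -> c \in L v -> #|colour_nbrs U L v c|%:R <= y) ->
    exists s, conflict_free U L s.

(** Cutting every list down to the ceiling of [x] can only lower colour degrees, so lists of one
    common size suffice. *)
Lemma colourable_of_exact (x y : R) : 0 <= x ->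
  (forall (n : nat) (U : {set V}) (L : V -> {set C}), x <= n%:R -> n%:R <= x + 1 ->
    (forall v, v \in U -> #|L v| = n) ->
    (forall v c, v \in U -> c \in L v -> #|colour_nbrs U L v c|%:R <= y) ->
    exists s, conflict_free U L s) ->
  colourable x y.
Proof.
move=> x0 h U L hL hd.
have exn : exists n, x <= n%:R by exists (Num.truncn x).+1; rewrite ltW // truncnS_gt.
case: (ex_minnP exn) => n xn min_n.
have nx : n%:R <= x + 1.
  case: n xn min_n => [|n] _ min_n; first by rewrite ltW // ltr_pwDr.
  rewrite -natr1 lerD2r leNgt; apply/negP => /ltW /min_n; by rewrite ltnn.
have pick v : exists S : {set C}, (v \in U) ==> (S \subset L v) && (#|S| == n).
  case vU: (v \in U); last by exists set0.
  have [S SL Sn] := subset_of_card (min_n _ (hL v vU)).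
  by exists S; rewrite SL Sn eqxx.
pose L' v := xchoose (pick v).
have L'P v : v \in U -> L' v \subset L v /\ #|L' v| = n.
  by move=> vU; have /implyP/(_ vU)/andP[? /eqP] := xchooseP (pick v).
case: (h n U L' xn nx) => [v vU|v c vU cL|s [sL sE]]; first by case: (L'P v vU).
  have [/subsetP sub _] := L'P v vU.
  apply: le_trans (hd v c vU (sub c cL)); rewrite ler_nat subset_leq_card //.
  apply/subsetP => u; rewrite !inE => /and3P[uU -> cu]; rewrite uU.
  by have [/subsetP-> //] := L'P u uU.
exists s; split=> // v vU; have [/subsetP sub _] := L'P v vU; exact/sub/sL.
Qed.

(** Local lemma for uniform random colours: a conflict has probability at most n ^ -2 and shares a
    vertex with at most 4 n y conflicts, so 4 n ^ -2 * 4 n y <= 1 is needed, which is the constant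
    16. The bound 2 <= x gives 4 n ^ -2 <= 1. *)
Lemma colourable_sparse (x y : R) : 2 <= x -> 16 * y <= x -> colourable x y.
Proof.
move=> x2 xy; apply: colourable_of_exact; first lra.
move=> n U L xn nx Ln dy.
have n0 : 0 < n%:R :> R by lra.
pose mu v (c : C) : R :=
  if v \in U then (c \in L v)%:R / n%:R else (c == c0)%:R.
have mu_ge0 v c : 0 <= mu v c by rewrite /mu; case: ifP => _; rewrite ?divr_ge0.
have mu_sum1 v : \sum_c mu v c = 1.
  rewrite /mu; case vU: (v \in U); last first.
    by rewrite (bigD1 c0) //= eqxx big1 ?addr0 // => c /negbTE ->.
  by rewrite -mulr_suml -natr_sum -big_mkcond /= sum1_card Ln // divff // gt_eqF.
(* Events are indexed by all triples; those that are not possible conflicts get the empty event on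
   no variables. *)
pose K (i : C * (V * V)) := [&& i.2.1 \in U, i.2.2 \in U, i.1 \in L i.2.1,
  i.1 \in L i.2.2 & E i.1 i.2.1 i.2.2].
pose B i (w : {ffun V -> C}) := [&& K i, w i.2.1 == i.1 & w i.2.2 == i.1].
pose vbl i := if K i then [set i.2.1; i.2.2] else set0.
case: (set_0Vmem U) => [U0|[v0 v0U]].
  by exists (fun=> c0); split=> [v|u v]; rewrite U0 inE.
have y0 : 0 <= y.
  have /card_gt0P[c cL] : (0 < #|L v0|)%N by rewrite Ln // -(ltr_nat R).
  exact: le_trans (dy _ _ v0U cL).
pose W a := [set p : C * V | [&& a \in U, p.1 \in L a & p.2 \in colour_nbrs U L a p.1]].
have cardW a : #|W a|%:R <= n%:R * y.
  case: (boolP (a \in U)) => aU; last first.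
    rewrite (_ : W a = set0) ?cards0 ?mulr_ge0 //.
    by apply/setP => p; rewrite !inE (negbTE aU).
  apply: (@le_trans _ _ (\sum_(c in L a) #|colour_nbrs U L a c|)%:R); last first.
    rewrite natr_sum -(Ln _ aU) mulr_natl -sumr_const.
    by apply: ler_sum => c cL; exact: dy.
  under [in leRHS]eq_bigr => c _ do rewrite -sum1_card.
  rewrite pair_big_dep -sum1_card /=.
  by rewrite ler_nat; apply: eq_leq; apply: eq_bigl => p; rewrite inE aU.
(* A conflict meeting [i] contains one of the two vertices of [i], as its first or as its second
   vertex: four families of at most n y conflicts. *)
have nbr_card i : #|[set j | ~~ [disjoint vbl i & vbl j]]|%:R <= 4 * (n%:R * y).
  pose F1 a := [set (p.1, (a, p.2)) | p in W a].
  pose F2 a := [set (p.1, (p.2, a)) | p in W a].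
  have F12 a : #|F1 a :|: F2 a|%:R <= 2 * (n%:R * y).
    apply: (@le_trans _ _ (#|W a| + #|W a|)%:R); last first.
      by rewrite natrD; move: (cardW a); lra.
    rewrite ler_nat; apply: leq_trans (leq_card_setU _ _) _.
    by rewrite leq_add // leq_imset_card.
  apply: (@le_trans _ _ #|(F1 i.2.1 :|: F2 i.2.1) :|: (F1 i.2.2 :|: F2 i.2.2)|%:R).
    rewrite ler_nat subset_leq_card //; apply/subsetP => j.
    rewrite [j \in _]inE => /pred0Pn[a /= /andP[ai aj]].
    have {ai} : a = i.2.1 \/ a = i.2.2.
      by move: ai; rewrite /vbl; case: ifP; rewrite !inE // => _ /orP[] /eqP; [left|right].
    have {aj} : j \in F1 a :|: F2 a.
      move: aj; rewrite /vbl; case: ifP; rewrite ?inE //.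
      case: j => c [u v] /= /and5P[/= uU vU cu cv Euv] /orP[] /eqP ->.
        apply/orP; left; apply/imsetP; exists (c, v) => //=.
        by rewrite !inE /= uU cu vU cv E_sym Euv.
      apply/orP; right; apply/imsetP; exists (c, u) => //=.
      by rewrite !inE /= uU cu vU cv Euv.
    by move=> ja [] <-; rewrite in_setU ja ?orbT.
  apply: (@le_trans _ _ (#|F1 i.2.1 :|: F2 i.2.1| + #|F1 i.2.2 :|: F2 i.2.2|)%:R).
    by rewrite ler_nat leq_card_setU.
  by rewrite natrD; move: (F12 i.2.1) (F12 i.2.2); lra.
have B_dep i : depends_on (vbl i) (B i).
  move=> w w'; rewrite /vbl /B; case: ifP => //= _ ww'.
  by rewrite !ww' // !inE eqxx ?orbT.
have coord v c : v \in U -> c \in L v -> Prob mu (fun w => w v == c) = n%:R^-1.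
  move=> vU cL; rewrite /Prob (expect_coord mu_sum1 v (fun a => (a == c)%:R)).
  rewrite (bigD1 c) //= big1 => [|a /negbTE ->]; last by rewrite mulr0.
  by rewrite eqxx addr0 mulr1 /mu vU cL mul1r.
have B_prob i : Prob mu (B i) <= n%:R ^- 2.
  rewrite /B; case: (boolP (K i)) => [|_]; last first.
    rewrite /Prob (eq_expect _ (g := fun=> 0)) // expect_cst //.
    by rewrite invr_ge0 exprn_ge0.
  move=> /and5P[uU vU cu cv Euv].
  rewrite expr2 invfM -{1}(coord i.2.1 i.1) // -(coord i.2.2 i.1) // /Prob.
  rewrite -(expectM mu_sum1 (S := [set i.2.1]) (S' := [set i.2.2])).
  - by apply: ler_expect => // w; rewrite -natrM mulnb.
  - by move=> w w' ->; rewrite // inE.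
  - by move=> w w' ->; rewrite // inE.
  - rewrite disjoints1 inE; apply: contraTneq Euv => ->; by rewrite E_irr.
have [|||w w0 wB] := @local_lemma _ _ _ _ mu_ge0 mu_sum1 _ B vbl (n%:R ^- 2)
    (Num.max 1 (4 * (n%:R * y))) B_dep B_prob.
- by move=> i; rewrite le_max nbr_card orbT.
- by rewrite le_max lexx.
- have n2 : 0 < n%:R ^+ 2 :> R by rewrite exprn_gt0.
  rewrite mulrAC ler_pdivrMr // mul1r maxr_pMr //.
  by rewrite ge_max; apply/andP; split; nra.
have wL v : v \in U -> w v \in L v.
  move=> vU; have : mu v (w v) != 0.
    by apply: contraTneq w0 => mu0; rewrite /weight (bigD1 v) //= mu0 mul0r ltxx.
  by rewrite /mu vU; case: (w v \in L v); rewrite ?mul0r ?eqxx.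
exists w; split=> [//|u v uU vU wuv].
have := wB (w u, (u, v)).
by rewrite /B /K /= uU vU wL // {1}wuv wL // wuv eqxx /= andbT.
Qed.




Definition adj u v := [exists c, E c u v].

Variable Delta : nat.
Hypothesis triangle_free : forall u v w, adj u v -> adj v w -> ~~ adj u w.
Hypothesis C4_free : forall u v w z,
  adj u v -> adj v w -> adj w z -> adj z u -> u = w \/ v = z.
Hypothesis adj_deg : forall v, (#|[set u | adj u v]| <= Delta)%N.

(** * One round *)

Section NibbleStep.

Variables (U : {set V}) (L : V -> {set C}) (n : nat) (p q y : R).
Hypothesis p01 : 0 < p < 1.
Hypothesis q_gt0 : 0 < q.
Hypothesis q_le : forall k : nat, k%:R <= y -> q <= (1 - p) ^+ k.
Hypothesis card_L : forall v, v \in U -> #|L v| = n.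
Hypothesis deg_L :
  forall v c, v \in U -> c \in L v -> #|colour_nbrs U L v c|%:R <= y.

Local Notation T := (V * C * bool)%type.
Local Notation Omega := {ffun T -> bool}.
Local Notation N := (colour_nbrs U L).

(* Coordinate [(v, c, true)] records that [v] tries the colour [c];
   coordinate [(v, c, false)] deletes [c] from the list of [v] by an extra coin
   whose bias makes the survival probability of [c] at [v] exactly [q]. *)
Definition success (t : T) : R :=
  if t.2 then p else
  if (t.1.1 \in U) && (t.1.2 \in L t.1.1) then
    1 - q / (1 - p) ^+ #|N t.1.1 t.1.2|
  else 0.

Definition trial (t : T) (a : bool) : R := if a then success t else 1 - success t.

Let p1_gt0 : 0 < 1 - p.
Proof. by rewrite subr_gt0; case/andP: p01. Qed.

Let p1_ge0 : 0 <= 1 - p.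
Proof. exact: ltW. Qed.

Let trial_ge0 t a : 0 <= trial t a.
Proof.
suff /andP[s0 s1] : 0 <= success t <= 1 by case: a; rewrite /= ?subr_ge0.
have /andP[p0 p1] := p01; rewrite /success; case: t => -[v c] [] /=.
  by rewrite !ltW.
case: ifP => [/andP[vU cL]|_]; last by rewrite lexx ler01.
rewrite subr_ge0 ler_pdivrMr ?exprn_gt0 // mul1r q_le ?deg_L //=.
by rewrite gerBl divr_ge0 ?exprn_ge0 // ltW.
Qed.

Let trial_sum1 t : \sum_a trial t a = 1.
Proof. by rewrite big_bool /trial /= addrC subrK. Qed.

Local Notation prob := (Prob trial).

Definition quiet (S : {set T}) (w : Omega) : bool := [forall (t | t \in S), ~~ w t].

Lemma quiet_dep S : depends_on S (quiet S).
Proof. by move=> w w' ww'; apply: eq_forallb_in => t tS; rewrite ww'. Qed.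

Lemma prob_quiet S : prob (quiet S) = \prod_(t in S) (1 - success t).
Proof.
rewrite /Prob (eq_expect _ (g := fun w : Omega => \prod_t (if t \in S then (~~ w t)%:R else 1))).
  rewrite (expect_prod _ (fun t a => if t \in S then (~~ a)%:R else 1)).
  rewrite [RHS]big_mkcond; apply: eq_bigr => t _; rewrite big_bool /=.
  by case: ifP; rewrite ?mulr0 ?mulr1 ?add0r // addrC subrK.
by move=> w; rewrite -big_mkcond /= /quiet natr_forall_in.
Qed.

Definition threats v c : {set T} :=
  (v, c, false) |: [set (u, c, true) | u in N v c].

(** The argument conditions on the trials at [z]; without that coordinate, the rest is independent
    of them as soon as [v] differs from [z]. *)
Definition threats_but z v c : {set T} := threats v c :\ (z, c, true).

Lemma mem_threats v c t : (t \in threats v c) =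
  (t.1.2 == c) && (if t.2 then t.1.1 \in N v c else t.1.1 == v).
Proof.
case: t => -[u a] b; rewrite in_setU1 /= !xpair_eqE; case: b; rewrite ?andbF ?andbT /=.
  apply/imsetP/andP => [[u' u'N [-> ->]]|[/eqP -> uN]]; first by rewrite eqxx.
  by exists u.
rewrite andbC; case: (_ && _) => //=; by apply/imsetP => -[].
Qed.

Lemma prob_threats v c : v \in U -> c \in L v -> prob (quiet (threats v c)) = q.
Proof.
move=> vU cL; rewrite prob_quiet big_setU1 /=; last by apply/imsetP => -[].
rewrite {1}/success /= vU cL subKr big_imset /=; last by move=> u u' _ _ [].
rewrite (eq_bigr (fun=> 1 - p)) // prodr_const.
by rewrite divfK // expf_neq0 // gt_eqF.
Qed.

Lemma prob_threats_but z v c : v \in U -> c \in L v ->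
  q <= prob (quiet (threats_but z v c)) <= q / (1 - p).
Proof.
move=> vU cL; have q0 := ltW q_gt0; have qp := prob_threats vU cL.
have p0 : 0 <= p by case/andP: p01 => /ltW.
case: (boolP ((z, c, true) \in threats v c)) => zt.
  move: qp; rewrite !prob_quiet (big_setD1 _ zt) /= {1}/success /= => qp.
  have -> : \prod_(t in threats_but z v c) (1 - success t) = q / (1 - p).
    by rewrite -qp mulrC mulKf // gt_eqF.
  by rewrite lexx andbT ler_pdivlMr // ler_piMr // gerBl.
rewrite /threats_but [_ :\ _](_ : _ = threats v c).
  by rewrite qp lexx /= ler_pdivlMr // ler_piMr // gerBl.
by apply/setP => t; rewrite in_setD1; case: eqP => // ->; rewrite (negbTE zt).
Qed.

Definition hits z u c : pred Omega :=
  fun w => w (u, c, true) && quiet (threats_but z u c) w.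

(* Given that [z] tries exactly the colours of [S] in its list, the vertex [u]
   can only remain a [c]-neighbour of [z] if this holds; the trials at [z] do
   not matter here, also when [u] and [z] are joined by parallel edges. *)
Definition lingers z (S : {set C}) u c : pred Omega := fun w =>
  quiet (threats_but z u c) w && [forall (a | a \in L u :\: (c |: S)), ~~ hits z u a w].

Definition closed_nbhd u : {set V} := [set v | (v == u) || adj v u].

(** The slice of [zone z u] in one colour. Slices of different colours are disjoint, which makes the
    fates of different colours at [u] independent. *)
Definition colour_zone z u c : {set T} :=
  [set t | [&& t.1.2 == c, t.1.1 \in closed_nbhd u & t.1.1 != z]].

Definition zone z u : {set T} := [set t | (t.1.1 \in closed_nbhd u) && (t.1.1 != z)].

Lemma threats_but_zone z u c : u != z -> threats_but z u c \subset colour_zone z u c.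
Proof.
move=> uz; apply/subsetP => t; rewrite in_setD1 mem_threats !inE.
case: t => -[v a] b /=; rewrite !xpair_eqE; case: (a =P c) => //= _; last by rewrite andbF.
rewrite andbT.
case: b => /=; last by move=> /andP[_ /eqP ->]; rewrite eqxx uz.
rewrite eqxx !andbT => /and4P[-> _ Evu _]; rewrite andbT.
by apply/orP; right; apply/existsP; exists c.
Qed.

Lemma hits_dep z u c : u != z -> depends_on (colour_zone z u c) (hits z u c).
Proof.
move=> uz w w' ww'; rewrite /hits ww' ?inE ?eqxx //=; congr (_ && _).
by apply: depends_on_sub ww'; [exact: threats_but_zone|exact: quiet_dep].
Qed.

Lemma lingers_dep z S u c : u != z -> depends_on (zone z u) (lingers z S u c).
Proof.
move=> uz w w' ww'.
have wc a : forall t, t \in colour_zone z u a -> w t = w' t.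
  by move=> t; rewrite inE => /andP[_ tz]; apply: ww'; rewrite inE.
rewrite /lingers (depends_on_sub (threats_but_zone c uz) (@quiet_dep _) (wc c)).
by congr (_ && _); apply: eq_forallb_in => a _; rewrite (hits_dep uz (wc a)).
Qed.

Lemma prob_hits z u c : u \in U -> c \in L u -> p * q <= prob (hits z u c).
Proof.
move=> uU cL; have /andP[qb _] := prob_threats_but z uU cL.
have p0 : 0 <= p by case/andP: p01 => /ltW.
apply: le_trans (ler_wpM2l p0 qb) _; rewrite /Prob.
have <- : expect trial (fun w => (w (u, c, true))%:R) = p.
  rewrite (expect_coord trial_sum1 _ (fun a : bool => a%:R)) big_bool /=.
  by rewrite mulr0 addr0 mulr1.
rewrite -(expectM trial_sum1 (S := [set (u, c, true)]) (S' := threats_but z u c)).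
- by apply: ler_expect => // w; rewrite -natrM mulnb.
- by move=> w w' ->; rewrite // inE.
- by move=> w w' ww'; rewrite (quiet_dep ww').
- rewrite disjoints1 in_setD1 mem_threats /= !inE E_irr /=; by rewrite !andbF.
Qed.

(** Survival of [c] and the hits of the other colours live on disjoint slices. Survival has
    probability at most q / (1 - p), as one ignored trial costs a factor 1 - p at most, and each
    other colour fails to hit with probability at most 1 - p q. *)
Lemma prob_lingers z S u c : u \in U -> c \in L u -> u != z ->
  prob (lingers z S u c) <=
  q / (1 - p) * (1 - p * q) ^+ #|L u :\: (c |: S)|.
Proof.
move=> uU cL uz; have /andP[_ bq] := prob_threats_but z uU cL.
set K := L u :\: _.
rewrite /Prob (eq_expect _ (g := fun w =>
    (quiet (threats_but z u c) w)%:R * \prod_(a in K) (~~ hits z u a w)%:R)); last first.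
  move=> w; rewrite /lingers -(natr_forall_in R (mem K)) -natrM mulnb.
  by [].
have zone_neq a b : a != b -> [disjoint colour_zone z u a & colour_zone z u b].
  move=> ab; rewrite -setI_eq0; apply/eqP/setP => t; rewrite !inE.
  by case: (t.1.2 =P a) => [->|]; rewrite ?(negbTE ab) //= ?andbF.
rewrite (expectM trial_sum1 (S := colour_zone z u c)
   (S' := \bigcup_(a in K) colour_zone z u a)); last first.
- apply/bigcup_disjointP => a; rewrite !inE negb_or => /andP[/andP[ac _] _].
  by rewrite zone_neq // eq_sym.
- move=> w w' ww'; apply: eq_bigr => a aK; congr ((~~ _)%:R).
  by apply: hits_dep => // t ta; apply: ww'; apply/bigcupP; exists a.
- move=> w w' ww'; congr (_%:R); congr nat_of_bool.
  by apply: (depends_on_sub (threats_but_zone c uz) (@quiet_dep _)).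
rewrite ler_pM ?expect_ge0 // => [w|]; first by rewrite prodr_ge0.
rewrite (expect_prod_indep trial_sum1 (S := colour_zone z u)); first last.
- by move=> a b _ _; exact: zone_neq.
- by move=> a aK w w' ww'; rewrite (hits_dep uz ww').
rewrite -prodr_const; apply: ler_prod => a; rewrite inE => /andP[_ aL].
apply/andP; split; first by apply: expect_ge0.
rewrite (eq_expect _ (g := fun w => 1 + (-1) * (hits z u a w)%:R)).
  by rewrite expectD expect_cst // expectZl mulN1r lerD2l lerN2 prob_hits.
by move=> w; case: (hits z u a w); rewrite /= ?mulr1 ?mulr0 ?addr0 ?subrr.
Qed.

Definition survives v c : pred Omega := quiet (threats v c).

Definition remains u : pred Omega := fun w =>
  [forall (a | a \in L u), ~~ (w (u, a, true) && survives u a w)].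

Definition tried v (w : Omega) : {set C} := [set a in L v | w (v, a, true)].

Lemma tried_dep v : depends_on [set t : T | t.1.1 == v] (tried v).
Proof.
by move=> w w' ww'; apply/setP => a; rewrite !inE ww' // inE.
Qed.

(** For a colour [a] outside [tried v w], the ignored trial of [a] at [v] either is no threat or did
    not happen. Hence [hits] would mean that [u] really gets [a]. *)
Lemma remains_lingers v u c w : v \in U -> c \in L v -> u \in N v c ->
  remains u w -> survives u c w -> lingers v (tried v w) u c w.
Proof.
move=> vU cL uN /forall_inP ru sc; apply/andP; split.
  by apply/forall_inP => t; rewrite in_setD1 => /andP[_ /(forall_inP sc)].
apply/forall_inP => a; rewrite inE in_setU1 negb_or => /andP[/andP[_ aS] aL].
apply: contra (ru a aL) => /andP[-> qa] /=; apply/forall_inP => t tt.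
have [tv|tv] := eqVneq t (v, a, true); last first.
  by move/forall_inP: qa; apply; rewrite in_setD1 tv.
move: tt; rewrite tv mem_threats eqxx /= !inE => /and3P[_ _ aLv].
by apply: contra aS => wa; rewrite inE aLv.
Qed.

(** This is where short cycles are excluded: a vertex other than [v] common to both closed
    neighbourhoods would close a triangle or a 4-cycle through [v]. *)
Lemma zone_disjoint v u u' : adj u v -> adj u' v -> u != u' ->
  [disjoint zone v u & zone v u'].
Proof.
move=> uv u'v uu'; rewrite -setI_eq0; apply/eqP/setP => -[[z c] b].
rewrite !inE /=; apply/negP => /andP[/andP[zu zv] /andP[zu' _]].
have adjC a d : adj a d = adj d a by apply: eq_existsb => e; rewrite E_sym.
have vu : adj v u by rewrite adjC.
have vu' : adj v u' by rewrite adjC.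
case/orP: zu => [/eqP zu|uz].
  case/orP: zu' => [zu'|u'z]; first by rewrite -zu zu' in uu'.
  by have := triangle_free uv vu'; rewrite -zu u'z.
case/orP: zu' => [/eqP zu'|u'z].
  by have := triangle_free u'v vu; rewrite -zu' uz.
rewrite adjC in u'z.
case: (C4_free uv vu' u'z uz) => [e|e]; first by rewrite e eqxx in uu'.
by rewrite e eqxx in zv.
Qed.

Lemma list_tail v (d x : R) : v \in U -> 0 <= d <= 1 -> 0 <= x <= n%:R ->
  prob (fun w => \sum_(c in L v) (survives v c w)%:R <= (1 - d) * q * x) <=
  expR (- (d ^+ 2 * (q * x) / 4)).
Proof.
move=> vU d01 /andP[x0 xn].
apply: (lower_tail trial_ge0 trial_sum1 (S := threats v)) => //.
- by move=> c _; exact: quiet_dep.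
- move=> a b _ _ ab; rewrite -setI_eq0; apply/eqP/setP => t.
  by rewrite in_setI !mem_threats in_set0; case: (t.1.2 =P a) => [->|]; rewrite ?(negbTE ab) ?andbF.
- exact: ltW.
- by move=> c cL; rewrite prob_threats.
- by rewrite card_L.
Qed.

(** Exponential moment at 1/2, with exp (1/2) - 1 <= 1; this crude bound suffices because [s] will
    lie far above the mean n p. The [+ 1] leaves room for the colour [c] that [lingers] sets aside
    together with [S]. *)
Lemma tried_tail v (s : R) : v \in U ->
  prob (fun w => s < #|tried v w|%:R + 1) <= expR (n%:R * p - (s - 1) / 2).
Proof.
move=> vU; pose B c : pred Omega := fun w => w (v, c, true).
have cardE w : #|tried v w|%:R = \sum_(c in L v) (B c w)%:R :> R.
  rewrite -natr_sum -sum1_card big_mkcond [in RHS]big_mkcond; congr (_%:R).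
  by apply: eq_bigr => c _; rewrite inE /B; case: (c \in L v); case: (w _).
have Bp c : prob (B c) = p.
  rewrite /Prob (expect_coord trial_sum1 _ (fun a : bool => a%:R)) big_bool /=.
  by rewrite mulr0 addr0 mulr1.
apply: (@le_trans _ _ (expect trial (fun w =>
    expR (- ((s - 1) / 2)) * expR (2^-1 * \sum_(c in L v) (B c w)%:R)))).
  apply: ler_expect => // w; case: (boolP (s < _)) => [ts|_]; last first.
    by rewrite mulr0n mulr_ge0 ?expR_ge0.
  rewrite mulr1n -expRD -[X in X <= _]expR0 ler_expR -cardE; lra.
rewrite expectZl [n%:R * p - _]addrC expRD ler_wpM2l ?expR_ge0 //.
apply: le_trans (expect_expR_sum trial_ge0 trial_sum1 (S := fun c => [set (v, c, true)]) _ _ _) _.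
- by move=> c _ w w' ww'; rewrite /B ww' // inE.
- move=> a b _ _ ab; rewrite disjoints1 inE !xpair_eqE eqxx andbT /=.
  by apply: contra ab => /eqP ->.
rewrite ler_expR; apply: (@le_trans _ _ (\sum_(c in L v) p)).
  apply: ler_sum => c _; rewrite Bp ler_piMr //; first by case/andP: p01 => /ltW.
  by have := @expR_sub1_le R 2^-1; lra.
by rewrite sumr_const card_L // mulr_natl.
Qed.

(* [s] bounds the number of colours tried at [v] on which we condition. *)
Lemma degree_tail v c (d s : R) : v \in U -> c \in L v -> 0 <= d <= 1 ->
  let a := q / (1 - p) * expR (- (p * q * (n%:R - s))) in
  prob (fun w =>
    (1 + d) * a * y <= \sum_(u in N v c) (remains u w && survives u c w)%:R) <=
  expR (n%:R * p - (s - 1) / 2) + expR (- (d ^+ 2 * (a * y) / 8)).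
Proof.
move=> vU cL d01; set a := q / (1 - p) * _; cbv zeta.
have /andP[p0 p1] := p01; have pq0 : 0 <= p * q by rewrite mulr_ge0 // ltW.
have pq1 : p * q <= 1.
  have q1 : q <= 1 by rewrite (q_le (k := 0)) // (le_trans _ (deg_L vU cL)).
  by rewrite -[leRHS](mulr1 1) ler_pM // ltW.
have a0 : 0 <= a by rewrite mulr_ge0 ?expR_ge0 ?divr_ge0 // ltW.
have adjN u : u \in N v c -> adj u v.
  by rewrite inE => /and3P[_ Euv _]; apply/existsP; exists c.
have neqN u : u \in N v c -> u != v.
  by rewrite inE => /and3P[_ Euv _]; apply: contraTneq Euv => ->; rewrite E_irr.
(* For fixed [S] the summands have disjoint zones, so the Chernoff bound applies. At least n - s
   colours are left at each neighbour, and (1 - p q) ^ (n - s) is absorbed into the exponential in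
   [a]. *)
pose Y S w : R := \sum_(u in N v c) (lingers v S u c w)%:R.
pose thr := (1 + d) * a * y.
have tailS (S : {set C}) : #|S|%:R + 1 <= s -> prob (fun w => thr <= Y S w) <= expR (- (d ^+ 2 * (a * y) / 8)).
  move=> Ss; apply: (upper_tail trial_ge0 trial_sum1 (S := zone v)) => //.
  - by move=> u /neqN uv; exact: lingers_dep.
  - by move=> u u' /adjN uv /adjN u'v; exact: zone_disjoint.
  - move=> u uN; have := uN; rewrite inE => /and3P[uU _ cu].
    apply: le_trans (prob_lingers S uU cu (neqN _ uN)) _.
    apply: ler_wpM2l; first by rewrite divr_ge0 // ltW.
    apply: (@le_trans _ _ (expR (- (p * q)) ^+ #|L u :\: (c |: S)|)).
      rewrite lerXn2r ?nnegrE ?expR_ge0 ?subr_ge0 //; exact: expR_ge1Dx.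
    rewrite -expRM_natl ler_expR mulrN lerN2 mulrC ler_wpM2r //.
    have : (#|L u| <= #|L u :\: (c |: S)| + (1 + #|S|))%N.
      rewrite -(cardsID (c |: S) (L u)) addnC leq_add2l.
      apply: leq_trans (_ : #|c |: S| <= _)%N; first by rewrite subset_leq_card ?subsetIr.
      by rewrite cardsU1 leq_add2r leq_b1.
    rewrite card_L // -(ler_nat R) !natrD; lra.
  - exact: deg_L.
(* Either many colours are tried at [v], or [tried v w] is some small [S], and then [Y S] dominates
   the colour degree. *)
apply: (@le_trans _ _ (prob (fun w => (s < #|tried v w|%:R + 1)%R) +
    \sum_(S : {set C} | #|S|%:R + 1 <= s)
       prob (fun w => (tried v w == S) && (thr <= Y S w)))).
  rewrite /Prob -expect_sum -expectD; apply: ler_expect => // w.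
  case: (boolP (_ <= \sum_(u in N v c) _)) => [big|_]; last by rewrite addr_ge0 ?sumr_ge0.
  case: (ltrP s) => [_|Ss] /=; first by rewrite lerDl sumr_ge0.
  rewrite add0r (bigD1 (tried v w)) //= eqxx /=.
  rewrite (_ : _ <= Y _ _) ?lerDl ?sumr_ge0 //.
  apply: le_trans big _; apply: ler_sum => u uN; rewrite ler_nat.
  by case: (boolP (_ && _)) => // /andP[ru su]; rewrite remains_lingers.
rewrite lerD ?tried_tail //.
apply: (@le_trans _ _ (\sum_(S : {set C})
    prob (fun w => tried v w == S) * expR (- (d ^+ 2 * (a * y) / 8)))); last first.
  rewrite -mulr_suml -expect_sum (eq_expect _ (g := fun=> 1)) ?expect_cst ?mul1r // => w.
  by rewrite (bigD1 (tried v w)) //= eqxx big1 ?addr0 // => S; rewrite eq_sym => /negbTE ->.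
rewrite [leRHS](bigID (fun S : {set C} => #|S|%:R + 1 <= s)) /= ler_wpDr //.
  by apply: sumr_ge0 => S _; rewrite mulr_ge0 ?expR_ge0 ?prob_ge0.
apply: ler_sum => S Ss; apply: le_trans (ler_wpM2l (prob_ge0 trial_ge0 _) (tailS S Ss)).
(* [tried v] reads coordinates at [v] only, and the zones avoid [v]. *)
rewrite /Prob -(expectM trial_sum1 (S := [set t : T | t.1.1 == v])
  (S' := \bigcup_(u in N v c) zone v u)).
- by apply: ler_expect => // w; rewrite -natrM mulnb.
- by move=> w w' ww'; rewrite (tried_dep ww').
- move=> w w' ww'; suff -> : Y S w = Y S w' by [].
  apply: eq_bigr => u uN; congr (_%:R).
  congr nat_of_bool; apply: lingers_dep (neqN _ uN) _ _ _ => t tu.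
  by apply: ww'; apply/bigcupP; exists u.
- apply/bigcup_disjointP => u uN; rewrite -setI_eq0; apply/eqP/setP => t.
  by rewrite !inE; case: (t.1.1 =P v) => //= _; rewrite ?andbF.
Qed.

(** Whether a neighbour of [v] remains depends on trials at its own neighbours, hence radius two. *)
Definition ball2 v : {set V} := \bigcup_(u in closed_nbhd v) closed_nbhd u.

Lemma closed_nbhd_sym u v : (u \in closed_nbhd v) = (v \in closed_nbhd u).
Proof.
rewrite !inE eq_sym; congr (_ || _); apply: eq_existsb => c; exact: E_sym.
Qed.

Lemma ball2_sym u v : (u \in ball2 v) = (v \in ball2 u).
Proof.
by apply/bigcupP/bigcupP => -[z zv uz]; exists z; rewrite // closed_nbhd_sym.
Qed.

Lemma closed_nbhd_sub_ball2 u v : u \in closed_nbhd v -> closed_nbhd u \subset ball2 v.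
Proof. exact: bigcup_sup. Qed.

Lemma card_ball2 v : (#|ball2 v| <= Delta.+1 ^ 2)%N.
Proof.
have card_nbhd u : (#|closed_nbhd u| <= Delta.+1)%N.
  rewrite (_ : closed_nbhd u = u |: [set z | adj z u]); last first.
    by apply/setP => z; rewrite !inE.
  by rewrite cardsU1 -add1n leq_add ?leq_b1.
apply: leq_trans (card_bigcup_le _ card_nbhd) _.
by rewrite expnS expn1 leq_mul2r card_nbhd orbT.
Qed.

Definition next_U (w : Omega) : {set V} := [set v in U | remains v w].

Definition next_L (w : Omega) v : {set C} := [set c in L v | survives v c w].

Lemma next_nbrs w v c : colour_nbrs (next_U w) (next_L w) v c =
  [set u in N v c | remains u w && survives u c w].
Proof.
apply/setP => u; rewrite !inE.
by case: (u \in U); case: (E c u v); case: (c \in L u); rewrite //= ?andbF.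
Qed.

Lemma threats_sub_nbhd v c t : t \in threats v c -> t.1.1 \in closed_nbhd v.
Proof.
rewrite mem_threats /closed_nbhd in_set => /andP[_]; case: t.2 => [|->//].
by rewrite inE => /and3P[_ Euv _]; apply/orP; right; apply/existsP; exists c.
Qed.

(** Degrees are controlled for every colour of the old list, surviving or not, so that a union bound
    over the fixed set [L v] applies. *)
Definition spoiled (x' y' : R) v : pred Omega := fun w => (v \in U) &&
  ((#|next_L w v|%:R < x') ||
   [exists (c | c \in L v), y' < #|colour_nbrs (next_U w) (next_L w) v c|%:R]).

Definition spoiled_zone v : {set T} :=
  if v \in U then [set t | t.1.1 \in ball2 v] else set0.

Lemma spoiled_dep x' y' v : depends_on (spoiled_zone v) (spoiled x' y' v).
Proof.
rewrite /spoiled_zone /spoiled => w w'; case: (v \in U) => //= ww'.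
have agree u : u \in closed_nbhd v ->
    survives u ^~ w =1 survives u ^~ w' /\ remains u w = remains u w'.
  move=> /closed_nbhd_sub_ball2/subsetP uv.
  have surv a : survives u a w = survives u a w'.
    by apply: quiet_dep => t /threats_sub_nbhd/uv tv; apply: ww'; rewrite inE.
  split=> //; apply: eq_forallb_in => a _; rewrite surv ww' // inE uv //.
  by rewrite inE eqxx.
congr (_ || _).
  congr (_%:R < _); apply: eq_card => c; rewrite !inE.
  have vn : v \in closed_nbhd v by rewrite inE eqxx.
  by have [su _] := agree v vn; rewrite su.
apply: eq_existsb_in => c cL; congr (_ < _%:R); rewrite !next_nbrs.
apply: eq_card => u; rewrite [LHS]inE [RHS]inE.
case uN: (u \in N v c) => //=.
have un : u \in closed_nbhd v.
  move: uN; rewrite !inE => /and3P[_ Euv _]; apply/orP; right.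
  by apply/existsP; exists c.
by have [su ru] := agree u un; rewrite su ru.
Qed.

Lemma prob_spoiled (d s x x' y' : R) v : 0 <= d <= 1 -> 0 <= x <= n%:R ->
  let a := q / (1 - p) * expR (- (p * q * (n%:R - s))) in
  x' <= (1 - d) * q * x -> (1 + d) * a * y <= y' ->
  prob (spoiled x' y' v) <=
  expR (- (d ^+ 2 * (q * x) / 4)) +
  n%:R * (expR (n%:R * p - (s - 1) / 2) + expR (- (d ^+ 2 * (a * y) / 8))).
Proof.
move=> d01 xn; set a := q / (1 - p) * _; cbv zeta => x'_le y'_ge.
case: (boolP (v \in U)) => vU; last first.
  rewrite /Prob (eq_expect _ (g := fun=> 0)) => [|w]; last by rewrite /spoiled (negbTE vU).
  by rewrite expect_cst // addr_ge0 ?mulr_ge0 ?addr_ge0 ?expR_ge0.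
apply: le_trans (lerD (list_tail vU d01 xn) (lexx _)).
rewrite -{1}(card_L vU) mulr_natl -sumr_const.
apply: (@le_trans _ _ (prob (fun w => \sum_(c in L v) (survives v c w)%:R <= (1 - d) * q * x) +
    \sum_(c in L v) prob (fun w => (1 + d) * a * y <=
       \sum_(u in N v c) (remains u w && survives u c w)%:R))); last first.
  by rewrite lerD2l; apply: ler_sum => c cL; exact: degree_tail.
rewrite /Prob -expect_sum -expectD; apply: ler_expect => // w.
rewrite /spoiled vU /=; case: (boolP (_ < x')) => [Lx|_] /=.
  have -> : \sum_(c in L v) (survives v c w)%:R <= (1 - d) * q * x.
    apply: le_trans _ x'_le; apply/ltW; apply: le_lt_trans Lx.
    rewrite -natr_sum ler_nat -sum1_card big_mkcond [in leqRHS]big_mkcond.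
    by apply: leq_sum => c _; rewrite inE; case: (c \in L v); case: (survives _ _ _).
  by rewrite lerDl sumr_ge0.
case: (boolP [exists (c | c \in L v), _]) => [/exists_inP[c cL yc]|_]; last first.
  by rewrite addr_ge0 ?sumr_ge0.
have count : (1 + d) * a * y <= \sum_(u in N v c) (remains u w && survives u c w)%:R.
  apply: le_trans y'_ge _; apply/ltW/(lt_le_trans yc).
  rewrite -natr_sum ler_nat -sum1_card next_nbrs big_mkcond [in leqRHS]big_mkcond.
  apply: leq_sum => u _; rewrite in_set.
  by case: (u \in N v c); case: (remains u w && _).
rewrite [X in _ + X](bigD1 c) //= count.
by rewrite addrCA lerDl addr_ge0 ?sumr_ge0.
Qed.

(** The local lemma yields an outcome with no spoiled vertex. The remaining vertices are coloured by
    the hypothesis on x' and y', the others by a colour that they tried and that survived. *)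
Lemma nibble_step (d s x x' y' : R) : 0 <= d <= 1 -> 0 <= x <= n%:R ->
  let a := q / (1 - p) * expR (- (p * q * (n%:R - s))) in
  x' <= (1 - d) * q * x -> (1 + d) * a * y <= y' ->
  4 * (expR (- (d ^+ 2 * (q * x) / 4)) +
    n%:R * (expR (n%:R * p - (s - 1) / 2) + expR (- (d ^+ 2 * (a * y) / 8)))) *
    Delta.+1%:R ^+ 4 <= 1 ->
  colourable x' y' -> exists s, conflict_free U L s.
Proof.
move=> d01 xn a x'_le y'_ge bound col.
have [||w _ good] := @local_lemma _ _ _ _ trial_ge0 trial_sum1 _ (spoiled x' y')
  spoiled_zone _ (Delta.+1%:R ^+ 4) (spoiled_dep x' y')
  (fun v => prob_spoiled v d01 xn x'_le y'_ge) _ _ bound.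
(* Two zones meet only when the balls of radius two meet, hence the fourth power. *)
- move=> v; rewrite -natrX ler_nat.
  have : (#|\bigcup_(z in ball2 v) ball2 z| <= Delta.+1 ^ 4)%N.
    apply: leq_trans (card_bigcup_le _ card_ball2) _.
    by rewrite -[4%N]/(2 + 2)%N expnD leq_mul2r card_ball2 orbT.
  apply: leq_trans; rewrite subset_leq_card //; apply/subsetP => u.
  rewrite inE => /pred0Pn[t /= /andP[]]; rewrite /spoiled_zone.
  case: (v \in U); case: (u \in U); rewrite ?inE // => tv tu.
  by apply/bigcupP; exists t.1.1; rewrite // ball2_sym.
- by rewrite exprn_ege1 // ler1n.
case: (col (next_U w) (next_L w)) => [v|v c|sig [sigL sigE]].
- rewrite inE => /andP[vU _]; have := good v; rewrite /spoiled vU negb_or.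
  by rewrite -leNgt => /andP[].
- rewrite !inE => /andP[vU _] /andP[cL _]; have := good v; rewrite /spoiled vU negb_or.
  by move=> /andP[_]; rewrite negb_exists_in => /forall_inP/(_ c cL); rewrite -leNgt.
pose taken v b := [&& b \in L v, w (v, b, true) & survives v b w].
have takenP v : v \in U -> ~~ remains v w -> exists b, taken v b.
  move=> vU; rewrite negb_forall_in => /exists_inP[b bL].
  by rewrite negbK => wb; exists b; rewrite /taken bL.
pose sigma v := if remains v w then sig v else odflt c0 [pick b | taken v b].
have sigma_taken v : v \in U -> ~~ remains v w -> taken v (sigma v).
  move=> vU rv; rewrite /sigma (negbTE rv); case: pickP => [//|none].
  by have [b] := takenP v vU rv; rewrite none.
have surv v : v \in U -> sigma v \in L v /\ survives v (sigma v) w.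
  move=> vU; case: (boolP (remains v w)) => rv.
    have := sigL v; rewrite /sigma rv !inE vU rv => /(_ isT) /andP[? ?].
    by split.
  by have /and3P[] := sigma_taken v vU rv.
(* A vertex coloured in this round tried its colour, which therefore died at all neighbours along
   edges of that label; this covers neighbours coloured now or later. *)
have quietE u v : u \in U -> v \in U -> ~~ remains u w -> sigma u = sigma v ->
    ~~ E (sigma u) u v.
  move=> uU vU ru uv; have [sv qv] := surv v vU.
  have /and3P[su wu _] := sigma_taken u uU ru.
  apply/negP => Euv; move/forall_inP: qv => /(_ (u, sigma u, true)).
  rewrite wu mem_threats /= uv eqxx /= !inE -uv uU Euv su => /(_ isT); by [].
exists sigma; split=> [v vU|u v uU vU uv]; first by case: (surv v vU).
case: (boolP (remains u w)) => ru; last exact: quietE.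
case: (boolP (remains v w)) => rv; last by rewrite E_sym uv quietE.
have := sigE u v; rewrite !inE uU vU ru rv => /(_ isT isT).
by move: uv; rewrite /sigma ru rv => -> /(_ erefl).
Qed.

End NibbleStep.

(** * Iterating rounds *)

Section NibbleRounds.

Variables eps Lam : R.
Hypothesis eps_bounds : 0 < eps <= 1 / 100.
Hypothesis Lam_ge2 : 2 <= Lam.
Hypothesis Delta_Lam : Delta.+1%:R ^+ 5 <= expR (10 * Lam).

(* The relative error [d] tolerated in a round has to be negligible against its
   relative gain [eps / (y / x)], where [y / x <= Lam]. *)
Let d : R := eps ^+ 2 / Lam.
Let q : R := expR (- (eps * (1 + eps))).

Let Lam_gt0 : 0 < Lam. Proof. by move: Lam_ge2; lra. Qed.

Let dE : d * Lam = eps ^+ 2.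
Proof. by rewrite /d divfK // gt_eqF. Qed.

Let d_bounds : 0 < d /\ d <= eps ^+ 2 / 2.
Proof.
have /andP[e0 e1] := eps_bounds; split; first by rewrite divr_gt0 ?exprn_gt0.
by rewrite ler_wpM2l ?sqr_ge0 // lef_pV2 ?posrE.
Qed.

Let q_bounds : 1 - eps - eps ^+ 2 <= q /\ q < 1.
Proof.
have /andP[e0 e1] := eps_bounds; split; last by rewrite expR_lt1; nra.
apply: le_trans (expR_ge1Dx _); lra.
Qed.

(** From 1 - p >= exp (- p / (1 - p)) and p / (1 - p) <= p (1 + eps) for p = eps / y <= eps / 2. The
    factor 1 + eps in [q] pays for this. *)
Lemma le_expn_1B (y : R) (k : nat) : 2 <= y -> k%:R <= y -> q <= (1 - eps / y) ^+ k.
Proof.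
move=> y2 ky; have /andP[e0 e1] := eps_bounds.
have y0 : 0 < y by lra.
set p := eps / y; have py : p * y = eps by rewrite /p divfK // gt_eqF.
have p0 : 0 < p by rewrite divr_gt0.
have p2 : p * 2 <= eps by rewrite -py ler_wpM2l // ltW.
have p1 : 0 < 1 - p by lra.
have base : expR (- (p / (1 - p))) <= 1 - p.
  rewrite expRN -[leRHS]invrK lef_pV2 ?posrE ?expR_gt0 ?invr_gt0 //.
  apply: le_trans (expR_ge1Dx _); rewrite -[X in X <= _]mul1r ler_pdivrMr //.
  by rewrite mulrDl divfK ?gt_eqF //; lra.
apply: (@le_trans _ _ (expR (- (p / (1 - p))) ^+ k)); last first.
  by rewrite lerXn2r ?nnegrE ?expR_ge0 // ltW.
rewrite -expRM_natl ler_expR mulrN lerN2.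
have ppe : p / (1 - p) <= p * (1 + eps).
  rewrite ler_pdivrMr // -mulrA ler_peMr ?(ltW p0) //; nra.
have -> : eps * (1 + eps) = y * (p * (1 + eps)) by rewrite mulrA [y * p]mulrC py.
apply: le_trans (ler_wpM2l (ler0n _ _) ppe) _.
by rewrite ler_wpM2r // mulr_ge0 // ?(ltW p0) //; lra.
Qed.

(** With z = eps q (1 - d), exp (- z / r) r <= r - z + z ^ 2 / r. Passing from z to eps costs 11/10
    eps ^ 2, the square costs 16 eps ^ 2 as r >= 1/16, and the relative errors, together at most 4
    d, cost 4 d r <= 4 eps ^ 2; 25 leaves some room. *)
Lemma round_degree (r : R) : 1 / 16 <= r <= Lam -> forall p, 0 < p <= d ->
  (1 + d) * (q / (1 - p) * expR (- (eps * q * (1 - d) / r)) * r) <=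
  (1 - d) * q * (r - (eps - 25 * eps ^+ 2)).
Proof.
move=> /andP[r0 rL] p /andP[p0 pd]; have /andP[e0 e1] := eps_bounds.
have [d0 de] := d_bounds; have [q0 q1] := q_bounds.
have r_gt0 : 0 < r by lra.
have q_gt0 : 0 < q by exact: expR_gt0.
have p1 : 0 < 1 - p by nra.
have d1 : d <= 1 / 100 by nra.
pose z := eps * q * (1 - d).
have z0 : 0 <= z by rewrite /z !mulr_ge0 // ?ltW //; lra.
have ze : z <= eps by rewrite /z -mulrA ler_piMr ?ltW //; nra.
have zl : eps - (11/10) * eps ^+ 2 <= z.
  have : 1 - eps - eps ^+ 2 - d <= q * (1 - d) by nra.
  rewrite /z -mulrA; nra.
pose h := expR (- (z / r)).
have h0 : 0 <= h by exact: expR_ge0.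
have hr : h * r <= r - z + 16 * eps ^+ 2.
  have zr : z / r * r = z by rewrite divfK // gt_eqF.
  have zr0 : 0 <= z / r by rewrite divr_ge0 // ltW.
  have := expRN_le zr0; rewrite -/h => /(ler_wpM2r (ltW r_gt0)).
  have : (z / r) ^+ 2 * r <= 16 * eps ^+ 2.
    rewrite expr2 -mulrA zr mulrAC ler_pdivrMr //; nra.
  by rewrite !mulrDl mul1r mulNr zr; lra.
have -> : (1 + d) * (q / (1 - p) * h * r) = (1 + d) * (q * (h * r)) / (1 - p).
  by field; rewrite gt_eqF.
rewrite ler_pdivrMr //.
have hr0 : 0 <= h * r by rewrite mulr_ge0 // ltW.
have dr : d * r <= eps ^+ 2 by rewrite -dE ler_wpM2l // ltW.
have key : (1 + 4 * d) * (h * r) <= r - (eps - 25 * eps ^+ 2) by nra.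
have -> : (1 - d) * q * (r - (eps - 25 * eps ^+ 2)) * (1 - p) =
   q * ((1 - d) * (1 - p) * (r - (eps - 25 * eps ^+ 2))) by ring.
rewrite mulrCA; apply: ler_wpM2l; first exact: ltW.
have dp : (1 + d) <= (1 - d) * (1 - p) * (1 + 4 * d).
  have : (1 - d) * (1 - d) <= (1 - d) * (1 - p) by rewrite ler_wpM2l; lra.
  move=> /(ler_wpM2r (_ : 0 <= 1 + 4 * d)) h1.
  apply: le_trans (h1 _); nra.
apply: le_trans (ler_wpM2r hr0 dp) _.
rewrite -[leLHS]mulrA ler_wpM2l // mulr_ge0 //; lra.
Qed.

Lemma nibble_round (x y : R) : x <= Delta%:R ->
  10 ^+ 4 * Lam ^+ 3 <= eps ^+ 4 * x -> x <= 16 * y -> y <= Lam * x ->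
  colourable ((1 - d) * q * x)
    ((1 - d) * q * x * (y / x - (eps - 25 * eps ^+ 2))) ->
  colourable x y.
Proof.
move=> xD xbig xy yx col; have /andP[e0 e1] := eps_bounds.
have [d0 de] := d_bounds; have [q0 q1] := q_bounds; have L2 := Lam_ge2.
have d1 : d <= 1 / 10 ^+ 4 by nra.
have q_gt0 : 0 < q by exact: expR_gt0.
have q98 : 98 / 100 <= q by nra.
(* After multiplication by Lam ^ 2 this is the hypothesis on [x], since (d Lam) ^ 2 = eps ^ 4. *)
have d2x : 10 ^+ 4 * Lam <= d ^+ 2 * x.
  have L20 : 0 < Lam ^+ 2 by rewrite exprn_gt0.
  rewrite -(ler_pM2r L20) [leRHS]mulrAC -exprMn dE.
  by rewrite -exprM -mulrA -exprS.
have x_big : 10 ^+ 4 * Lam <= x.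
  apply: le_trans d2x _; rewrite ler_piMl //; last by rewrite exprn_ile1 //; lra.
  rewrite -(pmulr_rge0 _ (_ : 0 < eps ^+ 4)) ?exprn_gt0 //.
  by apply: le_trans xbig; rewrite mulr_ge0 // exprn_ge0 // ltW.
have x0 : 0 < x by lra.
have y0 : 0 < y by lra.
have dx : 10 ^+ 4 * Lam <= d * x.
  apply: le_trans d2x _; rewrite expr2 -mulrA ler_piMl ?(mulr_ge0 (ltW d0) (ltW x0)) //; lra.
pose p := eps / y.
have py : p * y = eps by rewrite /p divfK // gt_eqF.
have p0 : 0 < p by rewrite divr_gt0.
have px : p * x <= 16 * eps by rewrite -py mulrCA ler_wpM2l // ltW.
have pd : p <= d.
  rewrite -(ler_pM2r x0); apply: le_trans px _; lra.
apply: colourable_of_exact => [|n U L xn nx Ln dy]; first exact: ltW.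
(* This makes n - s equal to (1 - d) x whatever the rounding in [n], while s >= d x is still large
   enough for [tried_tail]. *)
pose s : R := n%:R - (1 - d) * x.
have p01 : 0 < p < 1 by rewrite p0; lra.
have ns : n%:R - s = (1 - d) * x by rewrite /s; ring.
pose a : R := q / (1 - p) * expR (- (p * q * (n%:R - s))).
have a8 : 8 / 10 <= a.
  have : 84 / 100 <= expR (- (p * q * (n%:R - s))).
    apply: le_trans (expR_ge1Dx _); rewrite ns.
    have : p * q * ((1 - d) * x) <= p * x.
      rewrite (_ : p * q * _ = (p * x) * (q * (1 - d))); last by ring.
      by rewrite ler_piMr ?(mulr_ge0 (ltW p0) (ltW x0)) //; nra.
    lra.
  have : 98 / 100 <= q / (1 - p) by rewrite ler_pdivlMr; nra.
  set A1 := q / _; set A2 := expR _ => ? ?; rewrite -/A2 -[a]/(A1 * A2).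
  nra.
have np : n%:R * p <= 1.
  by apply: le_trans (ler_wpM2r (ltW p0) nx) _; nra.
have tail1 : expR (- (d ^+ 2 * (q * x) / 4)) <= expR (- (10 * Lam + 11)).
  rewrite ler_expR lerN2 mulrCA.
  have := ler_wpM2l (ltW q_gt0) d2x; nra.
have tail2 : expR (n%:R * p - (s - 1) / 2) <= expR (- (10 * Lam + 11)).
  by rewrite ler_expR /s; lra.
have tail3 : expR (- (d ^+ 2 * (a * y) / 8)) <= expR (- (10 * Lam + 11)).
  rewrite ler_expR lerN2.
  have : x / 20 <= a * y by nra.
  move=> /(ler_wpM2l (sqr_ge0 d)); lra.
apply: (nibble_step p01 q_gt0 _ Ln dy (d := d) (s := s) _ _ _ _ _ col) => //.
- by move=> k ky; apply: le_expn_1B => //; lra.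
- lra.
- by rewrite xn ltW.
- pose r := y / x; have r0 : 0 < r by rewrite divr_gt0.
  have rx : r * x = y by rewrite /r divfK // gt_eqF.
  have rb : 1 / 16 <= r <= Lam.
    by rewrite /r ler_pdivlMr // ler_pdivrMr // yx andbT; lra.
  have := round_degree rb (p := p); rewrite p0 pd => /(_ isT).
  move=> /(ler_wpM2r (ltW x0)); rewrite -/r.
  have -> : eps * q * (1 - d) / r = p * q * (n%:R - s).
    by rewrite ns -py -rx; field; rewrite gt_eqF.
  congr (_ <= _); last by ring.
  by rewrite -/a -rx; ring.
(* Each of the three tails is at most exp (- (10 Lam + 11)). Four powers of Delta + 1 come from the
   local lemma and one bounds [n]; [Delta_Lam] handles these, and exp 11 >= 12 handles the constant
   4 * 3. *)
apply: (@le_trans _ _ (12 * (Delta.+1%:R ^+ 5 * expR (- (10 * Lam + 11))))).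
  set t := expR (- (10 * Lam + 11)) in tail1 tail2 tail3 *.
  have t0 : 0 <= t by exact: expR_ge0.
  have D4 : 0 <= Delta.+1%:R ^+ 4 :> R by rewrite exprn_ge0.
  rewrite [12 * _](_ : _ = 4 * (3 * Delta.+1%:R * t) * Delta.+1%:R ^+ 4); last by ring.
  rewrite ler_wpM2r // ler_wpM2l //.
  have nD : n%:R <= Delta.+1%:R :> R by rewrite -natr1; lra.
  have D1 : 1 <= Delta.+1%:R :> R by rewrite ler1n.
  apply: (@le_trans _ _ (t + n%:R * (t + t))); last by nra.
  by rewrite lerD // ler_wpM2l // lerD.
rewrite opprD expRD.
have : expR (10 * Lam) * expR (- (10 * Lam)) = 1 by rewrite -expRD subrr expR0.
have := ler_wpM2r (expR_ge0 (- (10 * Lam))) Delta_Lam.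
have : expR (- 11) <= 1 / 12 :> R.
  rewrite expRN div1r lef_pV2 ?posrE ?expR_gt0 //.
  by apply: le_trans (expR_ge1Dx _); lra.
have := expR_ge0 (-11 : R); set e := expR (-11); set D := _ * expR (- _).
move=> e_ge0 e12 Dt te; rewrite mulrA -/D; nra.
Qed.

(** Here [n] bounds the number of rounds to come. A round lowers y / x by eps - 25 eps ^ 2 and costs
    [x] at most a factor exp (eps + 2 eps ^ 2); the exponential in the hypothesis keeps [x] large
    through all of them. *)
Lemma nibble (n : nat) (x y : R) : x <= Delta%:R ->
  10 ^+ 4 * Lam ^+ 3 * expR (n%:R * (eps + 2 * eps ^+ 2)) <= eps ^+ 4 * x ->
  y <= Lam * x -> y <= x * (1 / 16 + n%:R * (eps - 25 * eps ^+ 2)) ->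
  colourable x y.
Proof.
have /andP[e0 e1] := eps_bounds; have [d0 de] := d_bounds; have L2 := Lam_ge2.
have [q0 q1] := q_bounds; have q_gt0 : 0 < q by exact: expR_gt0.
set b := eps + 2 * eps ^+ 2; set a := eps - 25 * eps ^+ 2.
have a0 : 0 < a by rewrite /a; nra.
have b0 : 0 <= b by rewrite /b addr_ge0 ?mulr_ge0 ?sqr_ge0 // ltW.
have K0 : 0 < 10 ^+ 4 * Lam ^+ 3 by rewrite mulr_gt0 // exprn_gt0.
have dq : expR (- b) <= (1 - d) * q.
  rewrite (_ : - b = - eps ^+ 2 + - (eps * (1 + eps))); last by rewrite /b; ring.
  rewrite expRD ler_pM2r //.
  apply: le_trans (expRN_le (sqr_ge0 eps)) _.
  have : eps ^+ 2 ^+ 2 <= eps ^+ 2 / 2.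
    rewrite [leLHS]expr2 ler_wpM2l ?sqr_ge0 // expr2.
    have : eps * eps <= 1 / 100 * 1 by rewrite ler_pM ?(ltW e0) //; lra.
    lra.
  lra.
have start (m : nat) x' : 10 ^+ 4 * Lam ^+ 3 * expR (m%:R * b) <= eps ^+ 4 * x' ->
    10 ^+ 4 * Lam ^+ 3 <= eps ^+ 4 * x' /\ 2 <= x'.
  move=> h; have h' : 10 ^+ 4 * Lam ^+ 3 <= eps ^+ 4 * x'.
    apply: le_trans h; rewrite ler_peMr ?(ltW K0) //.
    by rewrite -[X in X <= _]expR0 ler_expR mulr_ge0.
  split=> //.
  have e4 : eps ^+ 4 <= 1 by rewrite exprn_ile1 //; lra.
  have x'0 : 0 < x' by rewrite -(pmulr_rgt0 _ (exprn_gt0 4 e0)); exact: lt_le_trans h'.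
  have : eps ^+ 4 * x' <= x' by rewrite ler_piMl // ltW.
  have : 1 <= Lam ^+ 3 by rewrite exprn_ege1 //; lra.
  move: h'; lra.
elim: n x y => [|n IHn] x y xD xbig yx yn; have [xb x2] := start _ _ xbig.
  apply: colourable_sparse => //; lra.
have x0 : 0 < x by lra.
(* The ratio may drop to 1/16 before the rounds are used up. *)
case: (lerP (16 * y) x) => xy; first exact: colourable_sparse.
apply: nibble_round => //; first exact: ltW.
set x' := (1 - d) * q * x.
have x'x : x' <= x by rewrite /x' ler_piMl ?(ltW x0) //; nra.
have x'0 : 0 < x' by rewrite /x' !mulr_gt0 //; nra.
have x'b : x * expR (- b) <= x' by rewrite mulrC /x' ler_wpM2r // ltW.
have rn : y / x - a <= 1 / 16 + n%:R * a.
  have : y / x <= 1 / 16 + n.+1%:R * a by rewrite ler_pdivrMr // mulrC.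
  by rewrite -[n.+1%:R]natr1; lra.
have rL : y / x - a <= Lam.
  have : y / x <= Lam by rewrite ler_pdivrMr.
  lra.
apply: IHn.
- exact: le_trans xD.
- apply: le_trans (ler_wpM2l (exprn_ge0 4 (ltW e0)) x'b).
  have -> : expR (n%:R * b) = expR (n.+1%:R * b) * expR (- b).
    by rewrite -expRD -[n.+1%:R]natr1 [(_ + 1) * b]mulrDl mul1r addrK.
  by rewrite mulrA [leRHS]mulrA ler_wpM2r ?expR_ge0.
- by rewrite mulrC ler_wpM2r // ltW.
- by rewrite ler_wpM2l // ltW.
Qed.

End NibbleRounds.

End ConflictColouring.

(** * Labelled multigraphs *)

Section Multigraph.

Variables (G : multigraph) (tau : edge G -> nat) (N : nat).

Local Notation V := (vertex G).
Local Notation C := 'I_N.+1.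

(** Labels above [N] are dropped: [N] will bound all listed colours, so edges with such labels cause
    no conflict. *)
Definition edge_rel (c : C) : rel V :=
  [rel u v | [exists e, (ends e == [set u; v]) && (tau e == c)]].

Lemma ends_neq (e : edge G) u v : ends e = [set u; v] -> u != v.
Proof.
by move=> euv; have := card_ends e; rewrite euv cards2; case: (u != v).
Qed.

Lemma edge_rel_sym c : symmetric (edge_rel c).
Proof. by move=> u v; apply: eq_existsb => e; rewrite setUC. Qed.

Lemma edge_rel_irr c : irreflexive (edge_rel c).
Proof.
move=> u; apply/negbTE/existsP => -[e /andP[/eqP /ends_neq]]; by rewrite eqxx.
Qed.

Lemma adj_edge u v : adj edge_rel u v -> exists e, ends e = [set u; v].
Proof. by case/existsP => c /existsP[e /andP[/eqP ? _]]; exists e. Qed.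

Lemma edge_eq (e f : edge G) u v w z : ends e = [set u; v] ->
  ends f = [set w; z] -> u != w -> u != z -> e != f.
Proof.
move=> eE fE uw uz; apply/eqP => ef; have : u \in ends f by rewrite -ef eE set21.
by rewrite fE !inE (negbTE uw) (negbTE uz).
Qed.

Lemma edge_rel_triangle_free u v w : ~ has_cycle G 3 ->
  adj edge_rel u v -> adj edge_rel v w -> ~~ adj edge_rel u w.
Proof.
move=> noC3 /adj_edge[e eE] /adj_edge[f fE]; apply/negP => /adj_edge[g gE].
have [uv vw uw] := And3 (ends_neq eE) (ends_neq fE) (ends_neq gE).
case: noC3; exists [tuple u; v; w], [tuple e; f; g]; split.
- by rewrite /= !inE negb_or uv uw vw.
- rewrite /= !inE negb_or (edge_eq eE fE) // (edge_eq (u := v) (v := u) _ gE) //=.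
  + by rewrite (edge_eq fE gE) // eq_sym.
  + by rewrite setUC.
  + by rewrite eq_sym.
- by case=> -[|[|[|//]]] i; rewrite !(tnth_nth u) (tnth_nth e) //= setUC.
Qed.

Lemma edge_rel_C4_free u v w z : ~ has_cycle G 4 ->
  adj edge_rel u v -> adj edge_rel v w -> adj edge_rel w z -> adj edge_rel z u ->
  u = w \/ v = z.
Proof.
move=> noC4 /adj_edge[e eE] /adj_edge[f fE] /adj_edge[g gE] /adj_edge[h hE].
case: (eqVneq u w) => [|uw]; first by left.
case: (eqVneq v z) => [|vz]; first by right.
have [uv vw wz zu] := And4 (ends_neq eE) (ends_neq fE) (ends_neq gE) (ends_neq hE).
case: noC4; exists [tuple u; v; w; z], [tuple e; f; g; h]; split.
- by rewrite /= !inE !negb_or uv uw vw vz wz eq_sym zu.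
- have eE' : ends e = [set v; u] by rewrite setUC.
  have fE' : ends f = [set w; v] by rewrite setUC.
  have [vu wv zw uz] : [/\ v != u, w != v, z != w & u != z] by split; rewrite eq_sym.
  have wu : w != u by rewrite eq_sym.
  rewrite /= !inE !negb_or (edge_eq eE fE) // (edge_eq eE gE) // (edge_eq eE' hE) //.
  by rewrite (edge_eq fE gE) // (edge_eq fE hE) // (edge_eq gE hE).
- by case=> -[|[|[|[|//]]]] i; rewrite !(tnth_nth u) (tnth_nth e).
Qed.

(** Each neighbour is the other end of an incident edge; parallel edges merely give the same
    neighbour again. *)
Lemma card_nbrs_le (P : pred (edge G)) v :
  (#|[set u | [exists e, (ends e == [set u; v]) && P e]]| <=
   #|[set e | (v \in ends e) && P e]|)%N.
Proof.
pose other e := odflt v [pick u | ends e == [set u; v]].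
apply: leq_trans (leq_imset_card other _); apply: subset_leq_card.
apply/subsetP => u; rewrite inE => /existsP[e /andP[/eqP eE Pe]].
apply/imsetP; exists e; first by rewrite inE eE set22.
rewrite /other; case: pickP => [u' /= /eqP eE'|/(_ u)]; last by rewrite eE eqxx.
have : u \in ends e by rewrite eE set21.
by rewrite eE' !inE (negbTE (ends_neq eE)) orbF => /eqP.
Qed.

Lemma degree_le (v : V) : (degree v <= max_degree G)%N.
Proof. exact: (leq_bigmax v). Qed.

Lemma edge_rel_adj_deg v : (#|[set u | adj edge_rel u v]| <= max_degree G)%N.
Proof.
apply: leq_trans (degree_le v); apply: leq_trans (_ : #|[set e | (v \in ends e) && true]| <= _)%N.
  apply: leq_trans (card_nbrs_le xpredT v); apply: subset_leq_card.
  apply/subsetP => u; rewrite !inE => /adj_edge[e eE]; apply/existsP; exists e.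
  by rewrite eE eqxx.
by rewrite subset_leq_card //; apply/subsetP => e; rewrite !inE andbT.
Qed.

Definition label_degree v (c : C) : nat :=
  #|[set e | (v \in ends e) && (tau e == c)]|.

Lemma sum_label_degree (S : {set C}) v :
  (\sum_(c in S) label_degree v c <= max_degree G)%N.
Proof.
apply: leq_trans (degree_le v); rewrite /label_degree /degree.
under eq_bigr => c _ do rewrite -sum1dep_card big_mkcond /=.
rewrite exchange_big -sum1dep_card [in leqRHS]big_mkcond; apply: leq_sum => e _ /=.
case: (v \in ends e) => /=; last by rewrite big1.
rewrite -big_mkcondr sum1dep_card -(cards1 (inord (tau e) : C)).
apply: subset_leq_card; apply/subsetP => c; rewrite !inE => /andP[_ /eqP ->].
by rewrite inord_val.
Qed.

(* By averaging, at most half of the [k] colours listed at [v] label more than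
   [2 Delta / k] edges at [v]. *)
Lemma half_list (S : {set C}) v k : #|S| = k -> (0 < max_degree G)%N ->
  (k <= 2 * #|[set c in S | label_degree v c * k <= 2 * max_degree G]%N|)%N.
Proof.
move=> Sk D0; set D := max_degree G; set S1 := [set c in S | _].
have SS1 : (#|S1| + #|S :\: S1| = k)%N.
  rewrite -Sk -(cardsID S1 S); congr (_ + _)%N; apply: eq_card => c.
  by rewrite !inE; case: (c \in S).
have : (#|S :\: S1| * (2 * D) <= k * D)%N.
  apply: leq_trans (_ : k * \sum_(c in S :\: S1) label_degree v c <= _)%N; last first.
    by rewrite leq_mul2l sum_label_degree orbT.
  rewrite [leqRHS]big_distrr -sum_nat_const /=; apply: leq_sum => c.
  rewrite in_setD inE negb_and -ltnNge => /andP[/orP[/negP nS cS|lt _]].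
    by case: nS.
  by rewrite [(k * _)%N]mulnC ltnW.
rewrite mulnA leq_pmul2r // mulnC; lia.
Qed.

End Multigraph.

(** Lists move into a finite colour type bounded by the largest listed colour and are thinned by
    [half_list]; all vertices start uncoloured. *)
Lemma choosable_of_colourable (R : realType) (G : multigraph) (k : nat) :
  (0 < k)%N -> (0 < max_degree G)%N ->
  (forall (tau : edge G -> nat) (N : nat),
     colourable (edge_rel tau (N := N)) (k%:R / 2)
       (2 * (max_degree G)%:R / k%:R : R)) ->
  adaptably_choosable G k.
Proof.
move=> k0 D0 col tau L Lk.
pose N := \max_v \max_(c <- enum_fset (L v)) c.
have LN v c : c \in L v -> (c < N.+1)%N.
  move=> cL; rewrite ltnS; apply: leq_trans (leq_bigmax v).
  by rewrite (big_rem c) //= leq_maxl.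
pose L1 v := [set c : 'I_N.+1 | (c : nat) \in L v].
have L1k v : #|L1 v| = k.
  rewrite -[RHS](Lk v) cardE -(size_map val (enum _)).
  apply: perm_size; apply: uniq_perm => [||c].
  - by rewrite map_inj_uniq ?enum_uniq //; exact: val_inj.
  - exact: fset_uniq.
  apply/mapP/idP => [[d]|cL]; first by rewrite mem_enum inE => ? ->.
  by exists (Ordinal (LN v c cL)) => //; rewrite mem_enum inE.
pose L2 v := [set c in L1 v | label_degree tau v c * k <= 2 * max_degree G]%N.
have [v _|v c _ cL|s [sL sE]] := col tau N [set: _] L2.
- rewrite ler_pdivrMr // mulrC -natrM ler_nat; exact: half_list.
- rewrite ler_pdivlMr ?ltr0n // -!natrM ler_nat.
  move: cL; rewrite !inE => /andP[_]; apply: leq_trans; rewrite leq_mul2r.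
  apply/orP; right; apply: leq_trans (card_nbrs_le _ v); apply: subset_leq_card.
  by apply/subsetP => u; rewrite [in X in X -> _]inE => /and3P[_ Euv _]; rewrite inE.
exists (fun v => val (s v)); split=> [v|[e [u [v [eE eu ev]]]]].
  by have := sL v; rewrite !inE => /(_ isT) /andP[].
have suv : s u = s v by apply: val_inj; rewrite /= -eu.
have /negP[] := sE u v (in_setT _) (in_setT _) suv.
by apply/existsP; exists e; rewrite eE eu !eqxx.
Qed.

Lemma adaptable_choosability_le (G : multigraph) k :
  adaptably_choosable G k -> (adaptable_choosability G <= k)%N.
Proof.
move=> Gk; rewrite /adaptable_choosability; case: ex_minnP => m _; apply.
exact/boolp.asboolP.
Qed.

(** * Choice of parameters *)

Section Asymptotics.

Variable R : realType.

(** The fifth-order term of the exponential series, with 120 = 5!, already dominates. *)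
Lemma expR_beats_pow4 (eta M : R) : 0 < eta -> exists K : R, 0 < K /\
  forall L : R, K <= L -> M * L ^+ 4 <= expR (eta * L).
Proof.
move=> e0; pose K := Num.max 1 (M * 120 / eta ^+ 5); exists K.
have K1 : 1 <= K by rewrite /K le_max lexx.
split=> [|L KL]; first by lra.
have L0 : 0 < L by lra.
apply: le_trans (_ : _ <= (eta * L) ^+ 5 / 5`!%:R) _.
  rewrite exprMn ler_pdivlMr // [L ^+ 5]exprSr.
  have e5 : 0 < eta ^+ 5 by rewrite exprn_gt0.
  have ML : M * 120 <= L * eta ^+ 5.
    by rewrite -ler_pdivrMr //; apply: le_trans KL; rewrite /K le_max lexx orbT.
  have L4 : 0 <= L ^+ 4 by rewrite exprn_ge0 // ltW.
  rewrite mulrAC [leRHS](_ : _ = L * eta ^+ 5 * L ^+ 4); last by ring.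
  exact: ler_wpM2r.
have := @expR_ge1Dxn R (eta * L) 4 (mulr_ge0 (ltW e0) (ltW L0)); lra.
Qed.

(** The choice of [k] gives y / x = 4 Delta / k ^ 2 <= Lam / (2 + eta / 2), called [rho]. About rho
    / eps rounds shrink [x] by at most a constant times Delta ^ (1/2 - eta/20). As [x] starts at
    order sqrt (Delta / Lam), a factor Delta ^ (eta/20) is left to beat the powers of Lam and 1 /
    eps. *)
Lemma nibble_parameters (eta : R) : 0 < eta <= 1 -> exists K : R, forall Delta : nat,
  K <= ln (Delta%:R : R) ->
  let Lam := ln (Delta%:R : R) in let eps := eta / 400 in
  let k := Num.truncn ((2 * Num.sqrt 2 + eta) * Num.sqrt (Delta%:R / Lam)) in
  let x : R := k%:R / 2 in let y : R := 2 * Delta%:R / k%:R in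
  [/\ 2 <= Lam, Delta.+1%:R ^+ 5 <= expR (10 * Lam), (0 < k)%N, x <= Delta%:R &
   exists n : nat,
   [/\ 10 ^+ 4 * Lam ^+ 3 * expR (n%:R * (eps + 2 * eps ^+ 2)) <= eps ^+ 4 * x,
   y <= Lam * x & y <= x * (1 / 16 + n%:R * (eps - 25 * eps ^+ 2))]].
Proof.
move=> /andP[eta0 eta1].
have eps0 : 0 < eta / 400 by rewrite divr_gt0.
have epsE : eta = 400 * (eta / 400) by rewrite mulrCA divff ?mulr1 // pnatr_eq0.
have eta20 : 0 < eta / 20 by rewrite divr_gt0.
have [K0 [K0_gt0 hK0]] := expR_beats_pow4 (2 * 10 ^+ 4 / (eta / 400) ^+ 4) eta20.
exists (Num.max K0 (16 / eta)) => Delta; rewrite ge_max => /andP[KL etaL] Lam eps k x y.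
rewrite -/eps in eps0 epsE hK0; rewrite -/Lam in KL etaL.
have Lam16 : 16 <= Lam by apply: le_trans etaL; rewrite ler_pdivlMr //; lra.
have Lam0 : 0 < Lam by lra.
pose t : R := Delta%:R; pose h : R := expR (Lam / 2); pose w := Num.sqrt (t / Lam).
have t0 : 0 < t.
  rewrite /t ltr0n lt0n; apply: contraTneq Lam0 => D0.
  by rewrite /Lam D0 ln0 // ltxx.
have tE : expR Lam = t by rewrite /Lam lnK.
have hh : h * h = t by rewrite -tE /h -expRD -splitr.
have h0 : 0 < h by exact: expR_gt0.
have hL : Lam ^+ 2 / 8 <= h.
  have L2 : 0 <= Lam / 2 by rewrite divr_ge0 // ltW.
  have := @expR_ge1Dxn R _ 1 L2; rewrite -/h.
  have -> : (2`!)%:R = 2 :> R by [].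
  have -> : 1 + (Lam / 2) ^+ 2 / 2 = 1 + Lam ^+ 2 / 8 by field.
  lra.
have ww : w ^+ 2 * Lam = t by rewrite /w sqr_sqrtr ?divfK ?gt_eqF // divr_ge0 // ltW.
have w0 : 0 < w by rewrite /w sqrtr_gt0 divr_gt0.
have wh : h <= w * Lam.
  rewrite -(@ler_pXn2r _ 2) ?nnegrE ?mulr_ge0 ?(ltW w0) ?(ltW h0) ?(ltW Lam0) //.
  rewrite exprMn [Lam ^+ 2]expr2 mulrA ww [h ^+ 2]expr2 hh ler_peMr ?(ltW t0) //; lra.
have hw : w <= h.
  rewrite -(@ler_pXn2r _ 2) ?nnegrE ?(ltW w0) ?(ltW h0) // [h ^+ 2]expr2 hh -ww.
  by rewrite ler_peMr ?sqr_ge0 //; lra.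
have wL : Lam / 8 <= w.
  rewrite -(ler_pM2r Lam0); apply: le_trans wh; apply: le_trans hL.
  by rewrite expr2 mulrAC.
have weta : 1 <= w * (eta / 2).
  have : 16 <= Lam * eta by rewrite -ler_pdivrMr.
  have := ler_wpM2r (ltW eta0) wL; lra.
have [s0 s1 s2] : [/\ 1 <= Num.sqrt 2 :> R, Num.sqrt 2 <= 3 / 2 :> R &
    Num.sqrt 2 ^+ 2 = 2 :> R].
  have sq : Num.sqrt 2 ^+ 2 = 2 :> R by rewrite sqr_sqrtr.
  have sq0 : 0 <= Num.sqrt 2 :> R by exact: sqrtr_ge0.
  by split=> //; nra.
set s := Num.sqrt 2 in s0 s1 s2 k x y *.
have kw : k%:R <= 4 * w.
  apply: (@le_trans _ _ ((2 * s + eta) * w)).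
    by rewrite truncn_le // mulr_ge0 ?(ltW w0) //; lra.
  by rewrite ler_wpM2r ?(ltW w0) //; lra.
(* Rounding [k] down loses less than 1, which half of the surplus eta w covers. *)
have wk : (2 * s + eta / 2) * w <= k%:R.
  have := truncnS_gt ((2 * s + eta) * w); rewrite -/k -[k.+1%:R]natr1.
  rewrite !mulrDl; move: weta; rewrite [w * _]mulrC; lra.
have k2w : 2 * w <= k%:R.
  by apply: le_trans wk; rewrite ler_wpM2r ?(ltW w0) //; lra.
have k0 : 0 < k%:R :> R by lra.
have kk : (8 + 2 * eta) * t <= k%:R ^+ 2 * Lam.
  rewrite -ww mulrA ler_wpM2r ?(ltW Lam0) //.
  apply: (@le_trans _ _ (((2 * s + eta / 2) * w) ^+ 2)).
    rewrite exprMn ler_wpM2r ?sqr_ge0 //; nra.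
  rewrite ler_pXn2r ?nnegrE ?(ltW k0) // mulr_ge0 ?(ltW w0) //; lra.
have h2 : 2 <= h by apply: le_trans hL; nra.
have t4 : 4 <= t by rewrite -hh; nra.
split.
- lra.
- rewrite expRM_natl tE -natr1 -/t -[10%N]/(2 * 5)%N exprM ler_pXn2r ?nnegrE ?sqr_ge0 //.
    nra.
  by rewrite addr_ge0 // ltW.
- by rewrite -(ltr0n R).
- by rewrite /x -/t -hh; nra.
pose rho := Lam / (2 + eta / 2).
have d0 : 0 < 2 + eta / 2 by lra.
have rho0 : 0 < rho by rewrite divr_gt0.
have rhoE : rho * (2 + eta / 2) = Lam by rewrite /rho divfK // gt_eqF.
have rhoL : rho <= Lam by nra.
pose a := eps - 25 * eps ^+ 2; pose b := eps + 2 * eps ^+ 2.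
have eps_le : eps <= 1 / 400 by rewrite /eps ler_wpM2r ?invr_ge0.
have a0 : 0 < a by rewrite subr_gt0 expr2 mulrA gtr_pMl //; clear -eps_le; lra.
(* The cost in [x] per unit of decrease of y / x is 1 up to O(eps). *)
have ba : b <= a * (1 + 30 * eps).
  have : eps ^+ 2 * eps <= eps ^+ 2 * (1 / 400) by rewrite ler_wpM2l ?sqr_ge0.
  by have := sqr_ge0 eps; rewrite /a /b; clear; lra.
have yrho : y <= rho * x.
  rewrite /y /x ler_pdivrMr // -/t -(ler_pM2r d0).
  have -> : rho * (k%:R / 2) * k%:R * (2 + eta / 2) =
    k%:R ^+ 2 * (rho * (2 + eta / 2)) / 2 by ring.
  by rewrite rhoE; clear -kk; lra.
have x0 : 0 < x by rewrite /x; lra.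
pose n := (Num.truncn (rho / a)).+1; exists n.
have na : rho <= n%:R * a by have := truncnS_gt (rho / a); rewrite -/n ltr_pdivrMr // => /ltW.
have na' : n%:R * a <= rho + a.
  rewrite /n -natr1 mulrDl mul1r lerD2r -ler_pdivlMr // truncn_le //.
  by rewrite divr_ge0 // ltW.
split.
- pose F := expR (- (eta / 20 * Lam)).
  have F0 : 0 <= F by exact: expR_ge0.
  have EF : expR (eta / 20 * Lam) * F = 1 by rewrite -expRD subrr expR0.
  have half : expR (1 / 2) <= 2 :> R.
    by have := @expR_sub1_le R (1 / 2); clear; lra.
  have bound : n%:R * b <= 1 / 2 + (Lam / 2 + - (eta / 20 * Lam)).
    (* Here eps = eta / 400 is small enough: the left side is 1 + 3 eta / 40, the right side at
       least 1 + eta / 8. *)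
    have r1 : 1 + 30 * eps <= (2 + eta / 2) * (1 / 2 - eta / 20).
      have : eta * eta <= eta by rewrite ler_piMl // ltW.
      by clear -eta0 epsE; lra.
    have r2 : rho * (1 + 30 * eps) <= Lam * (1 / 2 - eta / 20).
      by rewrite -rhoE -[leRHS]mulrA ler_wpM2l // ltW.
    have nb : n%:R * b <= (rho + a) * (1 + 30 * eps).
      apply: le_trans (ler_wpM2l (ler0n _ _) ba) _; rewrite mulrA ler_wpM2r //.
      by clear -eps0; lra.
    have a_le : a * (1 + 30 * eps) <= 1 / 2.
      have : a <= eps by rewrite /a gerBl mulr_ge0 ?sqr_ge0.
      by clear -a0 eps0 eps_le; nra.
    by clear -nb a_le r2; lra.
  have nbF : expR (n%:R * b) <= 2 * h * F.
    apply: (@le_trans _ _ (expR (1 / 2 + (Lam / 2 + - (eta / 20 * Lam))))).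
      by rewrite ler_expR.
    by rewrite expRD [expR (_ + - _)]expRD -/h -/F -mulrA ler_wpM2r // mulr_ge0 // ltW.
  have e4 : 0 < eps ^+ 4 by rewrite exprn_gt0.
  rewrite -(ler_pM2r Lam0); apply: (@le_trans _ _ (2 * 10 ^+ 4 * Lam ^+ 4 * (h * F))).
    rewrite [leRHS](_ : _ = 10 ^+ 4 * Lam ^+ 3 * (2 * h * F) * Lam); last by ring.
    rewrite ler_wpM2r ?(ltW Lam0) // ler_wpM2l // mulr_ge0 ?exprn_ge0 // ltW //.
  have := hK0 Lam KL; rewrite mulrAC ler_pdivrMr // => EL.
  apply: le_trans (ler_wpM2r (mulr_ge0 (ltW h0) F0) EL) _.
  rewrite [leLHS](_ : _ = eps ^+ 4 * h * (expR (eta / 20 * Lam) * F)); last by ring.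
  rewrite EF mulr1 -[leRHS]mulrA ler_wpM2l ?(ltW e4) //; apply: le_trans wh _.
  by rewrite ler_wpM2r ?(ltW Lam0) // /x; clear -k2w; lra.
- by apply: le_trans yrho _; rewrite ler_wpM2r ?(ltW x0).
- apply: le_trans yrho _; rewrite mulrC ler_wpM2l ?(ltW x0) // -/a.
  by clear -na; lra.
Qed.

End Asymptotics.

(** * Bounds in terms of the maximum degree and the error term *)

(** A crude bound valid for each positive maximum degree, so that the error term is well defined for
    small Delta too; k = 64 Delta makes [colourable_sparse] apply at once. *)
Lemma adaptable_choosability_le_linear (R : realType) (G : multigraph) :
  (0 < max_degree G)%N -> (adaptable_choosability G <= 64 * max_degree G)%N.
Proof.
move=> D0; apply: adaptable_choosability_le.
apply: (@choosable_of_colourable R) => // [|tau N]; first by rewrite muln_gt0.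
have D1 : 1 <= (max_degree G)%:R :> R by rewrite ler1n.
apply: (colourable_sparse (edge_rel_sym tau (N := N)) (edge_rel_irr tau (N := N)) ord0).
  by rewrite natrM; lra.
rewrite natrM mulrA ler_pdivrMr; last by lra.
nra.
Qed.

Lemma adaptable_choosability_eventually (R : realType) (eta : R) :
  0 < eta <= 1 -> exists D0 : nat, forall G : multigraph,
  ~ has_cycle G 3 -> ~ has_cycle G 4 -> (D0 <= max_degree G)%N ->
  (adaptable_choosability G <= Num.truncn
    ((2 * Num.sqrt 2 + eta) * Num.sqrt ((max_degree G)%:R / ln (max_degree G)%:R)))%N.
Proof.
move=> eta01; have [K hK] := nibble_parameters eta01.
exists (Num.truncn (expR K)).+1 => G C3 C4 DK.
have KD : expR K <= (max_degree G)%:R.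
  by apply/ltW/(lt_le_trans (truncnS_gt _)); rewrite ler_nat.
have D0 : 0 < (max_degree G)%:R :> R by exact: lt_le_trans (expR_gt0 K) KD.
have {}KD : K <= ln ((max_degree G)%:R : R).
  by rewrite -[K]expRK ler_ln ?posrE ?expR_gt0.
have [L2 D5 k0 xD [n [hx hy hn]]] := hK _ KD.
apply: adaptable_choosability_le; apply: (@choosable_of_colourable R) => //.
  by rewrite -(ltr0n R).
move=> tau N.
apply: (nibble (Delta := max_degree G) (edge_rel_sym tau (N := N))
  (edge_rel_irr tau (N := N)) ord0 _ _ _ _ L2 D5 xD hx hy hn).
- by move=> u v w; exact: edge_rel_triangle_free.
- by move=> u v w z; exact: edge_rel_C4_free.
- exact: edge_rel_adj_deg.
have /andP[e0 e1] := eta01.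
by rewrite divr_gt0 //= ler_pdivrMr //; lra.
Qed.

From mathcomp Require Import all_classical all_reals all_analysis.
Import numFieldNormedType.Exports.
Local Open Scope classical_set_scope.

Theorem theorem1p1 (R : realType) :
  exists2 o : nat -> R,
    o n @[n --> \oo] --> (0 : R) &
    forall G : multigraph,
      ~ has_cycle G 3 -> ~ has_cycle G 4 -> (2 <= max_degree G)%N ->
      let Delta := max_degree G in
      (adaptable_choosability G)%:R <=
        (2 * Num.sqrt 2 + o Delta) * Num.sqrt (Delta%:R / ln Delta%:R) :> R.
Proof.
(* [best D] is the least bound valid for all these graphs of maximum degree [D], and [o D] is the
   excess that it requires. The inequality then holds by construction, and convergence is what
   remains. *)
pose bounds D m := `[< forall G, ~ has_cycle G 3 -> ~ has_cycle G 4 ->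
  (2 <= D)%N -> max_degree G = D -> (adaptable_choosability G <= m)%N >].
have bounds_ex D : exists m, bounds D m.
  exists (64 * D)%N; apply/asboolP => G _ _ D2 DG; rewrite -DG.
  by apply: (adaptable_choosability_le_linear R); rewrite DG ltnW.
pose best D := ex_minn (bounds_ex D).
pose w D : R := Num.sqrt (D%:R / ln D%:R).
have w_gt0 D : (2 <= D)%N -> 0 < w D.
  move=> D2; have D0 : 0 < D%:R :> R by rewrite ltr0n ltnW.
  by rewrite sqrtr_gt0 divr_gt0 // ln_gt0 // ltr1n.
(* Truncation at 0 leaves only an upper bound to prove for the limit; [w D] is known to be positive
   only from D = 2 on. *)
pose o D : R := if (2 <= D)%N then Num.max 0 ((best D)%:R / w D - 2 * Num.sqrt 2) else 0.
exists o => [|G C3 C4 D2]; last first.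
  cbv zeta; have w0 := w_gt0 _ D2; rewrite -/(w _) -ler_pdivrMr // -lerBlDl.
  rewrite /o D2 le_max; apply/orP; right; rewrite lerD2r ler_pM2r ?invr_gt0 //.
  rewrite ler_nat /best; case: ex_minnP => m /asboolP bm _; exact: bm.
apply/cvgrPdist_le => eta eta0.
have eta1 : 0 < Num.min eta 1 <= 1 by rewrite lt_min eta0 ltr01 ge_min lexx orbT.
have [D0 hD0] := adaptable_choosability_eventually eta1.
exists D0 => // D /= DD0; rewrite sub0r normrN /o; case: ifP => D2; last first.
  by rewrite normr0 ltW.
rewrite ger0_norm ?le_max ?lexx // ge_max (ltW eta0) /= lerBlDl.
rewrite ler_pdivrMr ?w_gt0 //.
set z := (2 * Num.sqrt 2 + Num.min eta 1) * w D.
have s0 : 0 <= Num.sqrt 2 :> R by exact: sqrtr_ge0.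
have z0 : 0 <= z.
  by case/andP: eta1 => m0 _; rewrite mulr_ge0 ?(ltW (w_gt0 _ D2)) // addr_ge0 ?mulr_ge0 // ltW.
apply: (@le_trans _ _ z); last by rewrite ler_wpM2r ?(ltW (w_gt0 _ D2)) // lerD2l ge_min lexx.
apply: (@le_trans _ _ (Num.truncn z)%:R); last by rewrite truncn_le.
rewrite ler_nat /best; case: ex_minnP => m _; apply; apply/asboolP => G C3 C4 _ DG.
by have := hD0 G C3 C4; rewrite DG; exact.
Qed.
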